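(* Let $H$ be a Hopf algebra over $\mathbb{K}$ with antipode $S$, let $V$ be an object of the category ${}^H_H\mathcal{YD}$ of Yetter-Drinfeld modules over $H$ with natural braiding $\sigma$, and let $M=\{M_{pq}\}_{p,q\ge0}$ be a quantum multi-brace algebra structure on $(V,\sigma)$ such that all $M_{pq}$ are morphisms in ${}^H_H\mathcal{YD}$. Let $T(V)\#H$ be the bosonization of $(T(V),\ast)$ by $H$, let $P_0$ be the projection from $T(V)\#H=(\mathbb{K}\#H)\oplus(T^+(V)\#H)$ onto $H=\mathbb{K}\#H$, where $T^+(V)=\bigoplus_{i\ge1}V^{\otimes i}$, and let $\Sigma$ be the natural braiding on $T(V)\#H$ given by $$\Sigma\big((x\#h)\otimes(y\#h')\big)=\sum\big((x_{(-3)}h_{(1)})\cdot y\,\#\,x_{(-2)}h_{(2)}h'S(x_{(-1)}h_{(3)})\big)\otimes(x_{(0)}\#h_{(4)}).$$ Then the triple $(T(V)\#H,P_0,\Sigma)$ is a braided Rota-Baxter algebra of weight $-1$.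
   Context: $\mathbb{K}$ is a field of characteristic 0; everything is over $\mathbb{K}$; algebras are associative but not necessarily unital. $T(V)=\bigoplus_{i\ge 0}V^{\otimes i}$ is the tensor algebra (as a vector space); $\underline{\otimes}$ denotes the tensor product between $T(V)$ and $T(V)$. Sweedler notation: $\Delta(c)=\sum c_{(1)}\otimes c_{(2)}$, left coactions $\rho(m)=\sum m_{(-1)}\otimes m_{(0)}$, and iterates (e.g. $\sum x_{(-3)}\otimes x_{(-2)}\otimes x_{(-1)}\otimes x_{(0)}$). For a coproduct $\Delta$ on $C$: $\Delta^{(0)}=\mathrm{id}_C$, $\Delta^{(1)}=\Delta$, $\Delta^{(n+1)}=(\Delta^{(n)}\otimes\mathrm{id}_C)\circ\Delta$. Rota-Baxter algebra of weight $\lambda\in\mathbb{K}$: a pair $(R,P)$, $R$ an algebra, $P$ a linear endomorphism of $R$ with $P(x)P(y)=P(xP(y))+P(P(x)y)+\lambda P(xy)$ for all $x,y\in R$. Braiding: an invertible $\sigma\in\mathrm{End}(V\otimes V)$ with $(\sigma\otimes\mathrm{id})(\mathrm{id}\otimes\sigma)(\sigma\otimes\mathrm{id})=(\mathrm{id}\otimes\sigma)(\sigma\otimes\mathrm{id})(\mathrm{id}\otimes\sigma)$ on $V^{\otimes3}$; $(V,\sigma)$ is then a braided vector space, and $\sigma_i=\mathrm{id}_V^{\otimes i-1}\otimes\sigma\otimes\mathrm{id}_V^{\otimes n-i-1}$ on $V^{\otimes n}$. For $w$ in the symmetric group $\mathfrak{S}_n$ with reduced expression $w=s_{i_1}\cdots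 s_{i_l}$ ($s_i$ permuting $i$ and $i+1$), $T^\sigma_w=\sigma_{i_1}\cdots\sigma_{i_l}$ (well defined). $\beta:T(V)\underline{\otimes}T(V)\to T(V)\underline{\otimes}T(V)$ has restriction $\beta_{ij}=\beta_{i,j}=T^\sigma_{\chi_{ij}}$ to $V^{\otimes i}\underline{\otimes}V^{\otimes j}$, $i,j\ge1$, where $\chi_{ij}\in\mathfrak{S}_{i+j}$ sends $k\mapsto j+k$ ($1\le k\le i$), $i+k\mapsto k$ ($1\le k\le j$); $\beta_{0i},\beta_{i0}$ are identities. Braided algebra: $(A,m,\sigma)$ with $(A,m)$ an algebra and $\sigma$ a braiding on $A$ such that $(\mathrm{id}_A\otimes m)\sigma_1\sigma_2=\sigma(m\otimes\mathrm{id}_A)$ and $(m\otimes\mathrm{id}_A)\sigma_2\sigma_1=\sigma(\mathrm{id}_A\otimes m)$. Braided Rota-Baxter algebra of weight $\lambda$: a triple $(R,P,\sigma)$ such that $(R,\sigma)$ is a braided algebra, $P$ is an endomorphism of $R$ such that $(R,P)$ is a Rota-Baxter algebra of weight $\lambda$, and $\sigma(P\otimes P)=(P\otimes P)\sigma$. Quantum multi-brace algebra $(V,M,\sigma)$: a braided vector space $(V,\sigma)$ with operations $M_{pq}:V^{\otimes p}\otimes V^{\otimes q}\to V$, $p,q\ge0$, satisfying: (i) $M_{00}=0$, $M_{10}=\mathrm{id}_V=M_{01}$, $M_{n0}=0=M_{0n}$ for $n\ge2$; (ii) for $i,j,k\ge1$, $\beta_{1k}(M_{ij}\otimes\mathrm{id}_V^{\otimes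 k})=(\mathrm{id}_V^{\otimes k}\otimes M_{ij})\beta_{i+j,k}$ and $\beta_{i1}(\mathrm{id}_V^{\otimes i}\otimes M_{jk})=(M_{jk}\otimes\mathrm{id}_V^{\otimes i})\beta_{i,j+k}$; (iii) for all positive integers $i,j,k$, on $V^{\otimes i}\underline{\otimes}V^{\otimes j}\underline{\otimes}V^{\otimes k}$, $\sum_{r=1}^{i+j}M_{rk}\circ\big((M^{\otimes r}\circ\bigtriangleup_\beta^{(r-1)})\otimes\mathrm{id}_V^{\otimes k}\big)=\sum_{l=1}^{j+k}M_{il}\circ\big(\mathrm{id}_V^{\otimes i}\otimes(M^{\otimes l}\circ\bigtriangleup_\beta^{(l-1)})\big)$. Here $M:T(V)\underline{\otimes}T(V)\to V$ is the map with components $M_{pq}$, $\delta(v_1\otimes\cdots\otimes v_n)=\sum_{i=0}^n(v_1\otimes\cdots\otimes v_i)\underline{\otimes}(v_{i+1}\otimes\cdots\otimes v_n)$ is deconcatenation, $\bigtriangleup_\beta=(\mathrm{id}_{T(V)}\otimes\beta\otimes\mathrm{id}_{T(V)})\circ(\delta\otimes\delta)$ is a coproduct on $T(V)\underline{\otimes}T(V)$. With $\varepsilon:T(V)\to\mathbb{K}$ the projection, $\ast=(\varepsilon\otimes\varepsilon)+\sum_{n\ge1}M^{\otimes n}\circ\bigtriangleup_\beta^{(n-1)}:T(V)\underline{\otimes}T(V)\to T(V)$; it is known that $(T(V),\ast,\beta)$ is a braided algebra. Yetter-Drinfeld modules: objects of ${}^H_H\mathcal{YD}$ are vector spaces $V$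 with a left $H$-module structure $\cdot$ and a left $H$-comodule structure such that $\sum h_{(1)}v_{(-1)}\otimes h_{(2)}\cdot v_{(0)}=\sum(h_{(1)}\cdot v)_{(-1)}h_{(2)}\otimes(h_{(1)}\cdot v)_{(0)}$ for $h\in H$, $v\in V$; morphisms are linear maps that are module and comodule homomorphisms. Tensor products carry the diagonal action and coaction, and $T(V)$ is thereby an object. The natural braiding of $V$ is $\sigma(v\otimes w)=\sum v_{(-1)}\cdot w\otimes v_{(0)}$. Bosonization $T(V)\#H$: the space $T(V)\otimes H$ (with $x\otimes h$ written $x\#h$) with multiplication $(x\#h)(y\#h')=\sum x\ast(h_{(1)}\cdot y)\#h_{(2)}h'$ for $x,y\in T(V)$, $h,h'\in H$; this is an associative algebra.
   Formalization: The antipode S of H is assumed bijective; without this Σ need not be invertible (already for V = 0, when T(V)#H = H), so Σ would not be a braiding, and for every V invertibility of Σ forces S to be bijective. *)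

(* Defs.v *)
From HB Require Import structures.
From mathcomp Require Import all_boot all_algebra.
From mathcomp Require Import boolp zify.

Set Implicit Arguments.
Unset Strict Implicit.
Unset Printing Implicit Defensive.

Import GRing.Theory.
Local Open Scope ring_scope.
Local Open Scope quotient_scope.

(* Vector spaces by generators and relations.  [pres X adm] is the space of   *)
(* formal K-linear combinations of elements of [X], two of them being equal   *)
(* iff all admissible maps from [X] to K-vector spaces identify them.  With   *)
(* "admissible" = "bilinear" on [U * V] this is the tensor product of U and V *)
(* and with "admissible" = "multilinear" on words over V it is the tensor     *)
(* algebra T(V).                                                              *)
Section Presentation.
Variables (K : fieldType) (X : choiceType).
Variable adm : forall W : lmodType K, (X -> W) -> Prop.

Definition formal := seq (K * X).
Definition feval (W : lmodType K) (f : X -> W) (s : formal) : W :=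
  \sum_(p <- s) p.1 *: f p.2.

Definition feq (s t : formal) : bool :=
  `[< forall (W : lmodType K) (f : X -> W), adm f -> feval f s = feval f t >].

Fact feq_refl : reflexive feq. Proof. by move=> s; apply/asboolP. Qed.
Fact feq_sym : symmetric feq.
Proof. by move=> s t; apply/asboolP/asboolP => st W f /st. Qed.
Fact feq_trans : transitive feq.
Proof.
move=> t s u /asboolP st /asboolP tu; apply/asboolP => W f af.
by rewrite st // tu.
Qed.
Canonical feq_equiv := EquivRel feq feq_refl feq_sym feq_trans.

Definition pres_type := {eq_quot feq}.
HB.instance Definition _ := Choice.on pres_type.
HB.instance Definition _ := EqQuotient.on pres_type.

Definition plift (W : lmodType K) (f : X -> W) (x : pres_type) : W :=
  feval f (repr x).

Lemma plift_pi (W : lmodType K) (f : X -> W) s : adm f -> plift f (\pi_pres_type s) = feval f s.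
Proof.
move=> af; rewrite /plift.
by have /eqmodP/asboolP -> : repr (\pi_pres_type s) = s %[mod pres_type]
  by rewrite reprK.
Qed.

Lemma pres_ext (x y : pres_type) :
  (forall (W : lmodType K) (f : X -> W), adm f -> plift f x = plift f y) -> x = y.
Proof.
move=> xy; rewrite -[x]reprK -[y]reprK; apply/eqmodP/asboolP => W f af.
exact: xy.
Qed.

Definition pzero : pres_type := \pi_pres_type [::].
Definition padd (x y : pres_type) : pres_type := \pi_pres_type (repr x ++ repr y).
Definition pscale (a : K) (x : pres_type) : pres_type :=
  \pi_pres_type [seq (a * p.1, p.2) | p <- repr x].
Definition popp (x : pres_type) := pscale (-1) x.

Lemma plift0 (W : lmodType K) (f : X -> W) : adm f -> plift f pzero = 0.
Proof. by move=> af; rewrite plift_pi // /feval big_nil. Qed.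
Lemma pliftD (W : lmodType K) (f : X -> W) : adm f -> {morph plift f : x y / padd x y >-> x + y}.
Proof. by move=> af x y; rewrite plift_pi // /feval big_cat. Qed.
Lemma pliftZ (W : lmodType K) (f : X -> W) a :
  adm f -> {morph plift f : x / pscale a x >-> a *: x}.
Proof.
move=> af x; rewrite plift_pi // /feval big_map scaler_sumr.
by apply: eq_bigr => p _; rewrite scalerA.
Qed.
Definition pliftE := (plift0, pliftD, pliftZ).

Fact paddA : associative padd.
Proof. by move=> x y z; apply: pres_ext => W f af; rewrite !pliftE // addrA. Qed.
Fact paddC : commutative padd.
Proof. by move=> x y; apply: pres_ext => W f af; rewrite !pliftE // addrC. Qed.
Fact padd0 : left_id pzero padd.
Proof. by move=> x; apply: pres_ext => W f af; rewrite !pliftE // add0r. Qed.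
Fact paddN : left_inverse pzero popp padd.
Proof.
by move=> x; apply: pres_ext => W f af; rewrite !pliftE // scaleN1r addNr.
Qed.
HB.instance Definition _ := GRing.isZmodule.Build pres_type paddA paddC padd0 paddN.

Fact pscaleA a b x : pscale a (pscale b x) = pscale (a * b) x.
Proof. by apply: pres_ext => W f af; rewrite !pliftE // scalerA. Qed.
Fact pscale1 : left_id 1 pscale.
Proof. by move=> x; apply: pres_ext => W f af; rewrite !pliftE // scale1r. Qed.
Fact pscaleDr : right_distributive pscale +%R.
Proof.
by move=> a x y; apply: pres_ext => W f af; rewrite !pliftE // scalerDr.
Qed.
Fact pscaleDl x : {morph pscale^~ x : a b / a + b}.
Proof.
by move=> a b; apply: pres_ext => W f af; rewrite !pliftE // scalerDl.
Qed.
HB.instance Definition _ :=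
  GRing.Zmodule_isLmodule.Build K pres_type pscaleA pscale1 pscaleDr pscaleDl.

Definition pres : lmodType K := pres_type.
Definition pgen (x : X) : pres := \pi_pres_type [:: (1, x)].

Lemma plift_linear (W : lmodType K) (f : X -> W) :
  adm f -> linear (plift f : pres -> W).
Proof.
by move=> af a x y; rewrite (pliftD af (pscale a x) y) (pliftZ a af).
Qed.

Lemma plift_gen (W : lmodType K) (f : X -> W) x : adm f -> plift f (pgen x) = f x.
Proof. by move=> af; rewrite plift_pi // /feval big_seq1 scale1r. Qed.

Lemma pres_span (x : pres) : x = \sum_(p <- repr x) p.1 *: pgen p.2.
Proof.
apply: pres_ext => W f af.
pose L := GRing.isLinear.Build _ _ _ _ _ (plift_linear af).
pose g : {linear pres -> W} := HB.pack (plift f : pres -> W) L.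
rewrite -[plift f x]/(feval f (repr x)) -[RHS]/(g _) linear_sum /feval.
apply: eq_bigr => p _; rewrite linearZ /=; congr (_ *: _).
by rewrite -(plift_gen p.2 af).
Qed.

End Presentation.

Section Tensor.
Variable K : fieldType.
Implicit Types U V W : lmodType K.

Definition is_bilinear U V W (f : U -> V -> W) : Prop :=
  (forall v, linear (f^~ v)) /\ (forall u, linear (f u)).

Definition tens U V : lmodType K :=
  pres (fun W (f : U * V -> W) => is_bilinear (fun u v => f (u, v))).

Definition pure U V (u : U) (v : V) : tens U V := pgen _ (u, v).

(* The linear map on U (x) V induced by the bilinear map f (junk if f is not  *)
(* bilinear).                                                                 *)
Definition tlift U V W (f : U -> V -> W) (t : tens U V) : W :=
  plift (fun p => f p.1 p.2) t.

(* Words of length n span the degree-n part of T(V), the word [v_1; ..; v_n]  *)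
(* standing for v_1 (x) .. (x) v_n; the tensor powers of V are treated as the *)
(* homogeneous parts of T(V).                                                 *)
Definition is_multilinear V W (f : seq V -> W) : Prop :=
  forall s t, linear (fun v => f (s ++ v :: t)).

Definition talg V : lmodType K :=
  pres (fun W (f : seq V -> W) => is_multilinear f).

Definition word V (s : seq V) : talg V := pgen _ s.

Definition wlift V W (f : seq V -> W) (x : talg V) : W := plift f x.

End Tensor.

Notation "U \ox V" := (tens U%type V%type) (at level 40, left associativity) : type_scope.
Notation "u \ox v" := (pure u v) (at level 40, left associativity) : ring_scope.

(* Sweedler notation: \osum_(u, v <- t) E is the sum of the E(u_i, v_i) over  *)
(* any decomposition of t as a sum of u_i (x) v_i, for E bilinear in (u, v).  *)
Notation "\osum_ ( u , v <- t ) E" := (tlift (fun u v => E) t)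
  (at level 41, u name, v name, t at level 200, E at level 41,
   format "\osum_ ( u ,  v  <-  t )  E") : ring_scope.

Section TensorTheory.
Variable K : fieldType.
Implicit Types U V W : lmodType K.

Lemma tlift_pure U V W (f : U -> V -> W) u v :
  is_bilinear f -> tlift f (u \ox v) = f u v.
Proof. by move=> bf; rewrite /tlift plift_gen //=; case: bf. Qed.

Lemma tlift_linear U V W (f : U -> V -> W) : is_bilinear f -> linear (tlift f).
Proof. by move=> bf; apply: plift_linear. Qed.

Lemma pure_bilinear U V : is_bilinear (@pure K U V).
Proof.
split=> [v a u u'|u a v v']; apply: pres_ext => W f bf; rewrite /pure.
  rewrite (plift_linear bf) !(plift_gen _ bf) /=.
  by case: bf => bf _; apply: bf.
rewrite (plift_linear bf) !(plift_gen _ bf) /=.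
by case: bf => _ bf; apply: bf.
Qed.

Lemma tens_span U V (t : tens U V) :
  t = \sum_(p <- repr t) p.1 *: (p.2.1 \ox p.2.2).
Proof.
rewrite {1}[t]pres_span; apply: eq_bigr => p _; congr (_ *: _).
by rewrite /pure -surjective_pairing.
Qed.

Lemma wlift_word V W (f : seq V -> W) s : is_multilinear f -> wlift f (word s) = f s.
Proof. by move=> mf; rewrite /wlift plift_gen. Qed.

Lemma wlift_linear V W (f : seq V -> W) : is_multilinear f -> linear (wlift f).
Proof. by move=> mf; apply: plift_linear. Qed.

Lemma word_multilinear V : is_multilinear (@word K V).
Proof.
move=> s t a v w; apply: pres_ext => W f mf.
by rewrite (plift_linear mf) !(plift_gen _ mf); apply: mf.
Qed.

Lemma talg_span V (x : talg V) : x = \sum_(p <- repr x) p.1 *: word p.2.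
Proof. exact: pres_span. Qed.

End TensorTheory.

Section TensorMaps.
Variable K : fieldType.
Implicit Types U V W : lmodType K.

Definition tmap U U' V V' (f : U -> U') (g : V -> V') (t : U \ox V) : U' \ox V' :=
  \osum_(u, v <- t) (f u \ox g v).

Definition tassoc U V W (t : (U \ox V) \ox W) : U \ox (V \ox W) :=
  \osum_(a, w <- t) \osum_(u, v <- a) (u \ox (v \ox w)).

Definition tassocV U V W (t : U \ox (V \ox W)) : (U \ox V) \ox W :=
  \osum_(u, b <- t) \osum_(v, w <- b) ((u \ox v) \ox w).

Definition tcat V (x y : talg V) : talg V :=
  wlift (fun s => wlift (fun t => word (s ++ t)) y) x.

Definition counitT V (x : talg V) : K :=
  wlift (fun s => (nilp s)%:R : K^o) x.

Definition homog V (n : nat) (x : talg V) : talg V :=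
  wlift (fun s => if size s == n then word s else 0) x.

Definition deconc V (x : talg V) : talg V \ox talg V :=
  wlift (fun s => \sum_(0 <= i < (size s).+1) (word (take i s) \ox word (drop i s))) x.

(* The identification of the degree-n part of T(V), n >= i, with the tensor   *)
(* product of the parts of degree i and n - i.                                *)
Definition split_at V (i : nat) (x : talg V) : talg V \ox talg V :=
  wlift (fun s => word (take i s) \ox word (drop i s)) x.

(* [tpow W n] is the (n+1)-st tensor power of W.                              *)
Fixpoint tpow W (n : nat) : lmodType K :=
  if n is m.+1 then tens (tpow W m) W else W.

Fixpoint cop_iter (C : lmodType K) (D : C -> C \ox C) (n : nat) : C -> tpow C n :=
  match n return C -> tpow C n with
  | 0 => id
  | m.+1 => fun c => tmap (cop_iter D m) id (D c)
  end.

(* f^{(x)(n+1)}, with values in the degree-(n+1) part of T(V).                *)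
Fixpoint tpow_map W V (f : W -> V) (n : nat) : tpow W n -> talg V :=
  match n return tpow W n -> talg V with
  | 0 => fun w => word [:: f w]
  | m.+1 => fun t => \osum_(a, w <- t) tcat (tpow_map f a) (word [:: f w])
  end.

End TensorMaps.

(* A reduced expression of the permutation chi_{ij}, with positions numbered  *)
(* from 0: the letter p stands for the transposition of p and p + 1.          *)
Definition chi (i j k : nat) : nat :=
  if (k < i)%N then (j + k)%N else if (k < i + j)%N then (k - i)%N else k.
Definition chi_word (i j : nat) : seq nat :=
  flatten [seq rev (iota a j) | a <- iota 0 i].

Definition transp (p k : nat) : nat :=
  if k == p then p.+1 else if k == p.+1 then p else k.
(* s_{i_1} o .. o s_{i_l}                                                     *)
Definition word_perm (w : seq nat) (k : nat) : nat := foldr transp k w.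

Section ReducedExpression.

Local Ltac iflia := repeat (case: ifP => ?); lia.

Let word_perm_cat w w' k : word_perm (w ++ w') k = word_perm w (word_perm w' k).
Proof. by rewrite /word_perm foldr_cat. Qed.

Let word_perm_rev_iota a j k :
  word_perm (rev (iota a j)) k =
  if k == a then (a + j)%N else if (a < k <= a + j)%N then k.-1 else k.
Proof.
elim: j => [|j IH]; first by rewrite /word_perm /=; iflia.
rewrite -addn1 iotaD rev_cat word_perm_cat IH /word_perm /= /transp.
by case: (k =P a) => ?; [|case: (boolP (a < k <= a + j)%N) => ?]; iflia.
Qed.

Lemma chi_word_perm i j k : word_perm (chi_word i j) k = chi i j k.
Proof.
rewrite /chi_word; elim: i k => [|i IH] k; first by rewrite /chi /word_perm /=; iflia.
rewrite -addn1 iotaD map_cat flatten_cat word_perm_cat /= cats0 add0n IH.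
rewrite word_perm_rev_iota /chi addn1.
by case: (k =P i) => ?; [|case: (boolP (i < k <= i + j)%N) => ?]; iflia.
Qed.

Lemma size_chi_word i j : size (chi_word i j) = (i * j)%N.
Proof.
rewrite /chi_word size_flatten sumnE !big_map.
rewrite (eq_bigr (fun=> j)); last by move=> a _; rewrite size_rev size_iota.
by rewrite big_const_seq count_predT size_iota iter_addn_0 mulnC.
Qed.

Let transp_inj p : injective (transp p).
Proof. by move=> k l; rewrite /transp; iflia. Qed.

Let word_perm_inj w : injective (word_perm w).
Proof. by elim: w => [//|p w IH] k l /= /transp_inj /IH. Qed.

Let ninv n (f : nat -> nat) :=
  #|[set x : 'I_n * 'I_n | ((x.1 < x.2) && (f x.2 < f x.1))%N]|.

Let ninv_word n w : (ninv n (word_perm w) <= size w)%N.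
Proof.
elim: w => [|p w IH] /=.
  by rewrite leqn0 cards_eq0; apply/eqP/setP => -[a b]; rewrite !inE /=; lia.
set f := word_perm w in IH *.
pose E := [set x : 'I_n * 'I_n | (f x.1 == p) && (f x.2 == p.+1)].
have E1 : (#|E| <= 1)%N.
  apply/card_le1_eqP => -[a b] [a' b']; rewrite !inE /=.
  move=> /andP[/eqP fa /eqP fb] /andP[/eqP fa' /eqP fb'].
  by congr (_, _); apply/val_inj/(@word_perm_inj w); rewrite -/f ?fa ?fb.
apply: (@leq_trans (#|E| + ninv n f)%N); last by rewrite -add1n leq_add.
apply: leq_trans (leq_card_setU _ _); apply: subset_leq_card.
apply/subsetP => -[a b]; rewrite !inE /= -!/(word_perm _ _) -/f /transp.
move=> /andP[ab].
by rewrite ab /=; move: (f a) (f b) => x y; iflia.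
Qed.

Lemma chi_word_reduced i j w :
  word_perm w =1 chi i j -> (size (chi_word i j) <= size w)%N.
Proof.
move=> wE; rewrite size_chi_word; apply: leq_trans (ninv_word (i + j) w).
rewrite -[i in X in (X <= _)%N]card_ord -[j in X in (X <= _)%N]card_ord -card_prod.
pose g (x : 'I_i * 'I_j) := (lshift j x.1, rshift i x.2).
have g_inj : injective g by move=> [a b] [c d] [] /ord_inj-> /addnI/ord_inj->.
rewrite -(card_codom g_inj); apply: subset_leq_card.
apply/subsetP => _ /codomP[[a b] ->]; rewrite inE /= !wE /chi.
by have := ltn_ord a; have := ltn_ord b; iflia.
Qed.

End ReducedExpression.

Section Braidings.
Variable K : fieldType.
Implicit Types V A : lmodType K.

Definition sigma1 V (s : V \ox V -> V \ox V) (t : V \ox V \ox V) : V \ox V \ox V :=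
  tmap s id t.
Definition sigma2 V (s : V \ox V -> V \ox V) (t : V \ox V \ox V) : V \ox V \ox V :=
  tassocV (tmap id s (tassoc t)).

Definition braiding V (s : V \ox V -> V \ox V) : Prop :=
  [/\ linear s, bijective s &
      forall t, sigma1 s (sigma2 s (sigma1 s t)) = sigma2 s (sigma1 s (sigma2 s t))].

(* Algebras are not assumed to be unital.                                     *)
Definition is_algebra A (m : A -> A -> A) : Prop :=
  is_bilinear m /\ associative m.

Definition braided_algebra A (m : A -> A -> A) (s : A \ox A -> A \ox A) : Prop :=
  [/\ is_algebra m, braiding s,
      forall t : A \ox A \ox A,
        tmap id (tlift m) (tassoc (sigma1 s (sigma2 s t))) = s (tmap (tlift m) id t)
    & forall t : A \ox A \ox A,
        tmap (tlift m) id (sigma2 s (sigma1 s t)) = s (tmap id (tlift m) (tassoc t))].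

Definition rota_baxter (lambda : K) A (m : A -> A -> A) (P : A -> A) : Prop :=
  [/\ is_algebra m, linear P &
      forall x y,
        m (P x) (P y) = P (m x (P y)) + P (m (P x) y) + lambda *: P (m x y)].

Definition braided_rota_baxter (lambda : K) A (m : A -> A -> A) (P : A -> A)
    (s : A \ox A -> A \ox A) : Prop :=
  [/\ braided_algebra m s, rota_baxter lambda m P &
      forall t, s (tmap P P t) = tmap P P (s t)].

(* sigma acting on the letters at positions p and p + 1 (counted from 0).     *)
Definition sigma_at V (s : V \ox V -> V \ox V) (p : nat) (x : talg V) : talg V :=
  wlift (fun w =>
    if drop p w is v1 :: v2 :: w' then
      \osum_(u1, u2 <- s (v1 \ox v2)) word (take p w ++ [:: u1, u2 & w'])
    else 0) x.

(* sigma_{i_1} o .. o sigma_{i_l}                                             *)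
Definition braid_word V (s : V \ox V -> V \ox V) (w : seq nat) (x : talg V) : talg V :=
  foldr (sigma_at s) x w.

(* On degrees (i, j): T_{chi_ij}, followed by the identification of the part  *)
(* of degree i + j with the tensor product of those of degrees j and i.       *)
Definition beta V (s : V \ox V -> V \ox V) (t : talg V \ox talg V) :
    talg V \ox talg V :=
  \osum_(x, y <- t)
    wlift (fun a => wlift (fun b =>
      split_at (size b) (braid_word s (chi_word (size a) (size b)) (word (a ++ b)))) y) x.

End Braidings.

Section QuantumMultiBrace.
Variables (K : fieldType) (V : lmodType K).
Variable (s : V \ox V -> V \ox V) (M : talg V \ox talg V -> V).

Definition coprod_beta (t : talg V \ox talg V) :
    (talg V \ox talg V) \ox (talg V \ox talg V) :=
  \osum_(x, y <- t) \osum_(x1, x2 <- deconc x) \osum_(y1, y2 <- deconc y)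
    \osum_(y1', x2' <- beta s (x2 \ox y1)) ((x1 \ox y1') \ox (x2' \ox y2)).

(* M^{(x)r} o coprod_beta^{(r-1)}, for r >= 1.                                *)
Definition Mconv (r : nat) (t : talg V \ox talg V) : talg V :=
  tpow_map M (cop_iter coprod_beta r.-1 t).

(* The component M_{pq}, extended by 0 to all of T(V) (x) T(V).               *)
Definition Mcomp (p q : nat) (t : talg V \ox talg V) : V :=
  M (tmap (homog p) (homog q) t).

Record quantum_multibrace : Prop := QuantumMultiBrace {
  qmb_braiding : braiding s;
  qmb_linear : linear M;
  qmb_M00 : forall t, Mcomp 0 0 t = 0;
  qmb_M10 : forall v, Mcomp 1 0 (word [:: v] \ox word [::]) = v;
  qmb_M01 : forall v, Mcomp 0 1 (word [::] \ox word [:: v]) = v;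
  qmb_Mn0 : forall n t, (2 <= n)%N -> Mcomp n 0 t = 0;
  qmb_M0n : forall n t, (2 <= n)%N -> Mcomp 0 n t = 0;
  qmb_braidl : forall i j k (a : i.-tuple V) (b : j.-tuple V) (c : k.-tuple V),
    (0 < i)%N -> (0 < j)%N -> (0 < k)%N ->
    beta s (word [:: Mcomp i j (word a \ox word b)] \ox word c) =
    tmap id (fun x => word [:: Mcomp i j (split_at i x)])
      (beta s (word (a ++ b) \ox word c));
  qmb_braidr : forall i j k (a : i.-tuple V) (b : j.-tuple V) (c : k.-tuple V),
    (0 < i)%N -> (0 < j)%N -> (0 < k)%N ->
    beta s (word a \ox word [:: Mcomp j k (word b \ox word c)]) =
    tmap (fun x => word [:: Mcomp j k (split_at j x)]) id
      (beta s (word a \ox word (b ++ c)));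
  qmb_assoc : forall i j k (a : i.-tuple V) (b : j.-tuple V) (c : k.-tuple V),
    (0 < i)%N -> (0 < j)%N -> (0 < k)%N ->
    \sum_(1 <= r < (i + j).+1) Mcomp r k (Mconv r (word a \ox word b) \ox word c) =
    \sum_(1 <= l < (j + k).+1) Mcomp i l (word a \ox Mconv l (word b \ox word c))
}.

(* The sum over all n >= 1 is cut off at n = i + j in degrees (i, j): beyond, *)
(* every term of coprod_beta^{(n-1)} has a factor of degree (0, 0), which is  *)
(* killed by M_{00} = 0.                                                      *)
Definition star (x y : talg V) : talg V :=
  wlift (fun a => wlift (fun b =>
    (counitT (word a) * counitT (word b)) *: word [::] +
    \sum_(1 <= n < (size a + size b).+1) Mconv n (word a \ox word b)) y) x.

End QuantumMultiBrace.

Section Hopf.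
Variables (K : fieldType) (H : algType K).

Record hopf_algebra := HopfAlgebra {
  comul : H -> H \ox H;
  counit : H -> K;
  antipode : H -> H;
  comul_linear : linear comul;
  counit_linear : linear (counit : H -> K^o);
  antipode_linear : linear antipode;
  comulA : forall h, tassoc (tmap comul id (comul h)) = tmap id comul (comul h);
  counitl : forall h, \osum_(h1, h2 <- comul h) (counit h1 *: h2) = h;
  counitr : forall h, \osum_(h1, h2 <- comul h) (counit h2 *: h1) = h;
  comul1 : comul 1 = 1 \ox 1;
  comulM : forall g h, comul (g * h) =
    \osum_(g1, g2 <- comul g) \osum_(h1, h2 <- comul h) ((g1 * h1) \ox (g2 * h2));
  counit1 : counit 1 = 1;
  counitM : forall g h, counit (g * h) = counit g * counit h;
  antipodel : forall h, \osum_(h1, h2 <- comul h) (antipode h1 * h2) = (counit h)%:A;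
  antipoder : forall h, \osum_(h1, h2 <- comul h) (h1 * antipode h2) = (counit h)%:A
}.

End Hopf.

Section YetterDrinfeld.
Variables (K : fieldType) (H : algType K) (hopf : hopf_algebra H).
Implicit Types U V W : lmodType K.

(* Action and coaction, without axioms.                                       *)
Record hstruct V := HStruct { act : H -> V -> V; coact : V -> H \ox V }.

Record yetter_drinfeld V (Y : hstruct V) : Prop := YetterDrinfeld {
  act_bilinear : is_bilinear (act Y);
  act1 : forall v, act Y 1 v = v;
  actM : forall g h v, act Y (g * h) v = act Y g (act Y h v);
  coact_linear : linear (coact Y);
  coactA : forall v,
    tassoc (tmap (comul hopf) id (coact Y v)) = tmap id (coact Y) (coact Y v);
  coact_counit : forall v, \osum_(a, w <- coact Y v) (counit hopf a *: w) = v;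
  yd_compat : forall h v,
    \osum_(h1, h2 <- comul hopf h) \osum_(a, v0 <- coact Y v)
      ((h1 * a) \ox act Y h2 v0) =
    \osum_(h1, h2 <- comul hopf h) \osum_(a, v0 <- coact Y (act Y h1 v))
      ((a * h2) \ox v0)
}.

Definition yd_braiding V (Y : hstruct V) (t : V \ox V) : V \ox V :=
  \osum_(v, w <- t) \osum_(a, v0 <- coact Y v) (act Y a w \ox v0).

Definition yd_morphism U V (Y : hstruct U) (Z : hstruct V) (f : U -> V) : Prop :=
  [/\ linear f, forall h u, f (act Y h u) = act Z h (f u) &
      forall u, coact Z (f u) = tmap id f (coact Y u)].

Definition yd_tens U V (Y : hstruct U) (Z : hstruct V) : hstruct (U \ox V)%type :=
  HStruct
    (fun h t => \osum_(h1, h2 <- comul hopf h) tmap (act Y h1) (act Z h2) t)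
    (fun t => \osum_(u, v <- t) \osum_(a, u0 <- coact Y u) \osum_(b, v0 <- coact Z v)
      ((a * b) \ox (u0 \ox v0))).

(* Diagonal action and coaction on words; degree 0 carries the trivial ones.  *)
Fixpoint act_word V (Y : hstruct V) (h : H) (w : seq V) : talg V :=
  if w is v :: w' then
    \osum_(h1, h2 <- comul hopf h) tcat (word [:: act Y h1 v]) (act_word Y h2 w')
  else counit hopf h *: word [::].

Fixpoint coact_word V (Y : hstruct V) (w : seq V) : H \ox talg V :=
  if w is v :: w' then
    \osum_(a, v0 <- coact Y v) \osum_(b, x <- coact_word Y w')
      ((a * b) \ox tcat (word [:: v0]) x)
  else 1 \ox word [::].

Definition yd_talg V (Y : hstruct V) : hstruct (talg V) :=
  HStruct (fun h => wlift (act_word Y h)) (wlift (coact_word Y)).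

End YetterDrinfeld.

Section Bosonization.
Variables (K : fieldType) (H : algType K) (hopf : hopf_algebra H).
Variables (V : lmodType K) (Y : hstruct H V) (M : talg V \ox talg V -> V).

Let TY := yd_talg hopf Y.

Definition bosonization : lmodType K := (talg V \ox H)%type.

Definition bos_mul (a b : bosonization) : bosonization :=
  \osum_(x, h <- a) \osum_(y, h' <- b) \osum_(h1, h2 <- comul hopf h)
    (star (yd_braiding Y) M x (act TY h1 y) \ox (h2 * h')).

Definition bos_proj (a : bosonization) : bosonization :=
  \osum_(x, h <- a) ((counitT x *: word [::]) \ox h).

(* Its restriction to H, h (x) h' |-> h_1 h' S(h_2) (x) h_3, is bijective only *)
(* if the antipode S is.                                                      *)
Definition bos_braiding (t : bosonization \ox bosonization) :
    bosonization \ox bosonization :=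
  \osum_(a, b <- t) \osum_(x, h <- a) \osum_(y, h' <- b)
    \osum_(g123, x0 <- coact TY x)
    \osum_(g12, g3 <- comul hopf g123) \osum_(g1, g2 <- comul hopf g12)
    \osum_(h123, h4 <- comul hopf h)
    \osum_(h12, h3 <- comul hopf h123) \osum_(h1, h2 <- comul hopf h12)
      ((act TY (g1 * h1) y \ox (g2 * h2 * h' * antipode hopf (g3 * h3)))
        \ox (x0 \ox h4)).

End Bosonization.

(* Main.v *)
Require Import Defs.
From HB Require Import structures.
From mathcomp Require Import all_boot all_algebra zify.

(* H acts on itself by the adjoint action and coacts by its coproduct; this
   makes T(V)#H = T(V) (x) H a Yetter-Drinfeld module whose natural braiding is
   Sigma.  The natural braiding of a Yetter-Drinfeld module over a Hopf algebra
   with bijective antipode is a braiding, and it is compatible with every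
   product that is a morphism of modules and comodules; so the point is that
   T(V)#H is an associative algebra in the category.

   The map beta is the natural braiding of T(V), hence the product * of T(V) is
   a coalgebra map from T(V) (x) T(V), with its braided coproduct, to T(V).  As
   T(V) is cofree, the degree n+1 part of a coalgebra map into T(V) is
   determined by its degree n part and its projection to V.  Induction on the
   degree thus reduces the unit laws and the associativity of * to the axioms on
   the M_{pq}, which are exactly their projections to V.

   Finally P_0 is a morphism of Yetter-Drinfeld modules, hence commutes with
   Sigma, and an idempotent algebra endomorphism, hence Rota-Baxter of
   weight -1. *)

Set Implicit Arguments.
Unset Strict Implicit.
Unset Printing Implicit Defensive.

Import GRing.Theory.
Local Open Scope ring_scope.

(** * Sweedler sums *)

Section Lin.
Variable K : fieldType.
Implicit Types U V W X Z : lmodType K.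

(** Three encodings stand between the formulas and the argument. Tensors are classes of formal sums
    without normal form, so the axioms are restated against an arbitrary multilinear [F]; once
    nested Sweedler sums are normalised and reordered mechanically, the steps left over are genuine
    uses of axioms. The product [star] is a sum cut off at a bound depending on the words, which
    hides both its bilinearity and its recursion; it is studied through its homogeneous components
    [star_deg n], since an element of T(V) is determined by its components. The braiding [beta] is
    given by a reduced word of transpositions and has to be computed letter by letter.

    That H acts on T(V)#H compatibly with the product is seen without coordinates: the action is the
    inner one, a |-> h_1 a S(h_2), and such an action respects the product of any algebra into which
    H maps.

    The weight -1 comes from counting: for an idempotent algebra endomorphism P and X = P(a) P(b),
    each of P(a P(b)), P(P(a) b) and P(a b) equals X, and X = X + X - X. *)

Definition lin U W (f : U -> W) : Prop :=
  forall a u v, f (a *: u + v) = a *: f u + f v.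

Lemma lin0 U W (f : U -> W) : lin f -> f 0 = 0.
Proof. by move=> lf; rewrite -(subrr 0) addrC -scaleN1r lf scaleN1r addNr. Qed.

Lemma linD U W (f : U -> W) u v : lin f -> f (u + v) = f u + f v.
Proof. by move=> lf; rewrite -[u]scale1r lf !scale1r. Qed.

Lemma linZ U W (f : U -> W) a u : lin f -> f (a *: u) = a *: f u.
Proof. by move=> lf; rewrite -[a *: u]addr0 lf lin0 // addr0. Qed.

Lemma lin_sum U W (f : U -> W) I (r : seq I) (P : pred I) (E : I -> U) : lin f ->
  f (\sum_(i <- r | P i) E i) = \sum_(i <- r | P i) f (E i).
Proof.
move=> lf; elim/big_rec2: _ => [|i x y _ <-]; first exact: lin0.
by rewrite linD.
Qed.

Lemma lin_id U : lin (fun x : U => x). Proof. by []. Qed.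

Lemma lin_comp U V W (f : V -> W) (g : U -> V) :
  lin f -> lin g -> lin (fun x => f (g x)).
Proof. by move=> lf lg a u v; rewrite lg lf. Qed.

Lemma lin_scaler U W (c : K) (g : U -> W) : lin g -> lin (fun x => c *: g x).
Proof. by move=> lg a u v; rewrite lg scalerDr !scalerA mulrC. Qed.

Lemma lin_scalel U W (g : U -> K^o) (w : W) : lin g -> lin (fun x => g x *: w).
Proof. by move=> lg a u v; rewrite lg scalerDl scalerA. Qed.

Lemma lin_const0 U W : lin (fun _ : U => 0 : W).
Proof. by move=> a u v; rewrite scaler0 addr0. Qed.

Lemma lin_add U W (f g : U -> W) : lin f -> lin g -> lin (fun x => f x + g x).
Proof. by move=> lf lg a u v; rewrite lf lg scalerDr addrACA. Qed.

Lemma lin_bigsum U W I (r : seq I) (P : pred I) (F : U -> I -> W) :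
  (forall i, lin (fun x => F x i)) -> lin (fun x => \sum_(i <- r | P i) F x i).
Proof.
move=> lF a u v; rewrite scaler_sumr -big_split /=.
by apply: eq_bigr => i _; apply: lF.
Qed.

(* [tlift f t] is a sum over a representative of [t] even if [f] is not
   bilinear: extensionality, exchange of sums and the commutation with linear
   maps hold for every [f]. *)
Lemma tliftE U V W (f : U -> V -> W) t :
  tlift f t = \sum_(p <- repr t) p.1 *: f p.2.1 p.2.2.
Proof. by []. Qed.

Lemma eq_tlift U V W (f g : U -> V -> W) t :
  (forall u v, f u v = g u v) -> tlift f t = tlift g t.
Proof. by move=> fg; rewrite !tliftE; apply: eq_bigr => p _; rewrite fg. Qed.

Lemma lin_tliftl U V W X (f : U -> V -> W) (g : X -> U \ox V) :
  is_bilinear f -> lin g -> lin (fun x => tlift f (g x)).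
Proof. by move=> bf; apply: lin_comp; apply: tlift_linear. Qed.

Lemma lin_tliftr U V W X (f : X -> U -> V -> W) t :
  (forall u v, lin (fun x => f x u v)) -> lin (fun x => tlift (f x) t).
Proof.
move=> lf a x y; rewrite !tliftE scaler_sumr -big_split /=.
by apply: eq_bigr => p _; rewrite lf scalerDr !scalerA mulrC.
Qed.

Lemma lin_pure1 U V W (f : W -> U) (v : V) : lin f -> lin (fun x => f x \ox v).
Proof. by move=> lf a x y; rewrite lf; case: (pure_bilinear U V) => h _; apply: h. Qed.

Lemma lin_pure2 U V W (f : W -> V) (u : U) : lin f -> lin (fun x => u \ox f x).
Proof. by move=> lf a x y; rewrite lf; case: (pure_bilinear U V) => _ h; apply: h. Qed.

Lemma pureZl U V (c : K) (u : U) (v : V) : (c *: u) \ox v = c *: (u \ox v).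
Proof. by rewrite (linZ _ _ (f := fun x => x \ox v)) //; apply: lin_pure1. Qed.

Lemma pureZr U V (c : K) (u : U) (v : V) : u \ox (c *: v) = c *: (u \ox v).
Proof. by rewrite (linZ _ _ (f := fun x => u \ox x)) //; apply: lin_pure2. Qed.

Lemma app_tlift U V W X (g : W -> X) (f : U -> V -> W) t :
  lin g -> g (tlift f t) = tlift (fun u v => g (f u v)) t.
Proof.
move=> lg; rewrite !tliftE lin_sum //; apply: eq_bigr => p _; exact: linZ.
Qed.

Lemma tlift_tlift U V W X Z (g : W -> X -> Z) (f : U -> V -> W \ox X) t :
  is_bilinear g -> tlift g (tlift f t) = tlift (fun u v => tlift g (f u v)) t.
Proof. by move=> bg; apply: app_tlift; apply: tlift_linear. Qed.

Lemma tlift_exch U V U' V' W (f : U -> V -> U' -> V' -> W) t t' :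
  tlift (fun u v => tlift (fun u' v' => f u v u' v') t') t =
  tlift (fun u' v' => tlift (fun u v => f u v u' v') t) t'.
Proof.
rewrite !tliftE; under eq_bigr do rewrite tliftE scaler_sumr.
rewrite exchange_big /=; apply: eq_bigr => p _.
rewrite tliftE scaler_sumr; apply: eq_bigr => q _.
by rewrite !scalerA mulrC.
Qed.

(** One step of the tactic [pull]: a sum already at the front of the body is moved past one more
    enclosing sum. *)
Lemma tlift_pull U V U' V' W (f : U -> V -> W) (g : U -> V -> U' -> V' -> W) t t' :
  (forall u v, f u v = tlift (g u v) t') ->
  tlift f t = tlift (fun u' v' => tlift (fun u v => g u v u' v') t) t'.
Proof. by move=> fg; rewrite (eq_tlift _ fg) tlift_exch. Qed.

Lemma tlift_scale U V W (c : K) (f : U -> V -> W) t :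
  tlift (fun u v => c *: f u v) t = c *: tlift f t.
Proof. by rewrite (app_tlift (g := fun x => c *: x)) //; apply: lin_scaler. Qed.

Lemma tlift_add U V W (f g : U -> V -> W) t :
  tlift (fun u v => f u v + g u v) t = tlift f t + tlift g t.
Proof. by rewrite !tliftE -big_split; apply: eq_bigr => p _; rewrite scalerDr. Qed.

Lemma tliftD U V W (f : U -> V -> W) t t' : is_bilinear f ->
  tlift f (t + t') = tlift f t + tlift f t'.
Proof. by move=> bf; apply: linD; apply: tlift_linear. Qed.

Lemma wliftE V W (f : seq V -> W) x :
  wlift f x = \sum_(p <- repr x) p.1 *: f p.2.
Proof. by []. Qed.

Lemma lin_wliftr V W X (f : X -> seq V -> W) x :
  (forall s, lin (fun y => f y s)) -> lin (fun y => wlift (f y) x).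
Proof.
move=> lf a y z; rewrite !wliftE scaler_sumr -big_split /=.
by apply: eq_bigr => p _; rewrite lf scalerDr !scalerA mulrC.
Qed.

Lemma eq_wlift V W (f g : seq V -> W) x : f =1 g -> wlift f x = wlift g x.
Proof. by move=> fg; rewrite !wliftE; apply: eq_bigr => p _; rewrite fg. Qed.

Lemma tlift_id U V (t : U \ox V) : tlift (@pure K U V) t = t.
Proof. by rewrite tliftE -tens_span. Qed.

Lemma tens_ext U V W (f g : U \ox V -> W) : lin f -> lin g ->
  (forall u v, f (u \ox v) = g (u \ox v)) -> f =1 g.
Proof.
move=> lf lg fg t; rewrite (tens_span t) !lin_sum //.
by apply: eq_bigr => p _; rewrite !linZ // fg.
Qed.

Lemma tens3_ext U V W X (f g : U \ox V \ox W -> X) : lin f -> lin g ->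
  (forall u v w, f (u \ox v \ox w) = g (u \ox v \ox w)) -> f =1 g.
Proof.
move=> lf lg fg; apply: tens_ext => // t w; move: t.
apply: (@tens_ext _ _ _ (fun t => f (t \ox w)) (fun t => g (t \ox w))) => [||u v //].
  by apply: (lin_comp lf); apply: lin_pure1.
by apply: (lin_comp lg); apply: lin_pure1.
Qed.

Lemma lin_word1 V W (f : W -> V) : lin f -> lin (fun x => word [:: f x] : talg V).
Proof. by move=> lf a x y; rewrite lf; apply: (@word_multilinear K V [::] [::]). Qed.

Lemma talg_ext V W (f g : talg V -> W) : lin f -> lin g ->
  (forall s, f (word s) = g (word s)) -> f =1 g.
Proof.
move=> lf lg fg x; rewrite (talg_span x) !lin_sum //.
by apply: eq_bigr => p _; rewrite !linZ // fg.
Qed.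

End Lin.

Lemma lin_mull (K : fieldType) (H : algType K) (a : H) : lin (fun x : H => a * x).
Proof. by move=> c u v; rewrite mulrDr scalerAr. Qed.
Lemma lin_mulr (K : fieldType) (H : algType K) (a : H) : lin (fun x : H => x * a).
Proof. by move=> c u v; rewrite mulrDl scalerAl. Qed.

Create HintDb linbase.

Ltac lin_base := first [ assumption
  | match goal with H : _ |- _ => solve [apply H] end
  | solve [auto 1 with linbase nocore] ].

(* Decides [lin] and [is_bilinear] goals by recursion on the body; a head
   symbol must have its linearity in the context or in [linbase]. *)
Ltac lin :=
  cbv beta;
  lazymatch goal with
  | |- is_bilinear _ => split; lin
  | |- forall _, _ => intro; lin
  | |- GRing.linear_for _ ?f => change (lin f); lin
  | |- lin ?f =>
    lazymatch f with
    | (fun x => x) => apply lin_id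
    | (fun x => tlift (@?F x) (@?E x)) =>
      lazymatch E with
      | (fun _ => ?c) => apply (@lin_tliftr _ _ _ _ _ F c); lin
      | _ => lazymatch F with
             | (fun _ => ?F') => apply (@lin_tliftl _ _ _ _ _ F' E); lin
             end
      end
    | (fun x => pure (@?E x) (@?F x)) =>
      lazymatch E with
      | (fun _ => ?u) => apply (@lin_pure2 _ _ _ _ F u); lin
      | _ => lazymatch F with (fun _ => ?v) => apply (@lin_pure1 _ _ _ _ E v); lin end
      end
    | (fun x => GRing.scale (@?E x) (@?F x)) =>
      lazymatch E with
      | (fun _ => ?c) => apply (@lin_scaler _ _ _ c F); lin
      | _ => lazymatch F with (fun _ => ?v) => apply (@lin_scalel _ _ _ E v); lin end
      end
    | (fun x => word [:: @?E x]) => apply (@lin_word1 _ _ _ E); lin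
    | (fun x => GRing.add (@?E x) (@?F x)) => apply (@lin_add _ _ _ E F); lin
    | (fun x => GRing.mul (@?E x) (@?F x)) =>
      lazymatch E with
      | (fun _ => ?c) => apply (@lin_comp _ _ _ _ _ F (lin_mull c)); lin
      | _ => lazymatch F with (fun _ => ?v) => apply (@lin_comp _ _ _ _ _ E (lin_mulr v));
          lin end
      end
    | (fun x => @?g x) => first [ solve [lin_base] | lin_app f ]
    | ?g => first [ solve [lin_base] | change (lin (fun x => g x)); lin ]
    end
  end
with lin_app f :=
    match f with
    | (fun x => ?g (@?E x)) => apply (@lin_comp _ _ _ _ g E); [solve [lin_base] | lin]
    | (fun x => ?g (@?E x) ?c) => apply (@lin_comp _ _ _ _ (fun y => g y c) E);
        [solve [lin_base] | lin]
    | (fun x => ?g (@?E x) ?c ?d) => apply (@lin_comp _ _ _ _ (fun y => g y c d) E);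
        [solve [lin_base] | lin]
    | (fun x => ?g (@?E x) ?c ?d ?e) => apply (@lin_comp _ _ _ _ (fun y => g y c d e) E);
        [solve [lin_base] | lin]
    | (fun x => ?g (@?E x) ?c ?d ?e ?h) => apply (@lin_comp _ _ _ _ (fun y => g y c d e h) E);
        [solve [lin_base] | lin]
    | (fun x => ?g (@?E x) ?c ?d ?e ?h ?i) => apply (@lin_comp _ _ _ _ (fun y => g y c d e h i)
        E); [solve [lin_base] | lin]
    end.

(** The context around an inner sum, as a function; once [lin] has shown it linear, [app_tlift]
    moves the sum out of it. *)
Ltac ctxfun lhs p :=
  let h := eval pattern p in lhs in lazymatch h with ?g _ => constr:(g) end.

(* Normalises the left-hand side of an equation to nested sums over atoms and
   unifies it with the right-hand side; [hook] rewrites outside of binders. *)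
Ltac nrm hook :=
  cbv beta; repeat hook; cbv beta;
  lazymatch goal with
  | |- @tlift ?K ?U ?V ?W ?g ?t = _ =>
    lazymatch t with
    | pure ?u ?v => etransitivity; [apply (@tlift_pure _ _ _ _ g u v); lin | nrm hook]
    | ?c *: ?t' => etransitivity;
       [apply (@linZ _ _ _ (@tlift K U V W g) c t'); apply tlift_linear; lin | nrm hook]
    | context [@tlift ?K' ?U' ?V' ?W' ?f ?t'] =>
        let h := ctxfun (@tlift K U V W g t) (@tlift K' U' V' W' f t') in
        etransitivity; [apply (@app_tlift _ _ _ _ _ h f t'); lin | nrm hook]
    | _ => eapply eq_tlift; intros; nrm hook
    end
  | |- ?c *: @tlift _ _ _ _ ?f ?t = _ => etransitivity; [symmetry; apply tlift_scale | nrm hook]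
  | |- ?lhs = _ =>
    lazymatch lhs with
    | context [@tlift ?K' ?U' ?V' ?W' ?f ?t'] =>
        let h := ctxfun lhs (@tlift K' U' V' W' f t') in
        etransitivity; [apply (@app_tlift _ _ _ _ _ h f t'); lin | nrm hook]
    | _ => reflexivity
    end
  end.

Ltac nrmL hook := etransitivity; [solve [nrm hook] | cbv beta].
Ltac nrmR hook := apply: esym; etransitivity; [solve [nrm hook] | cbv beta; apply: esym].

(* [pull t] moves the sum over [t] of the left-hand side to the front. *)
Ltac pull_tac t := cbv beta;
  lazymatch goal with
  | |- tlift ?f t = _ => reflexivity
  | _ => eapply tlift_pull; intros; pull_tac t
  end.
Ltac pull t := etransitivity; [pull_tac t | cbv beta].
Ltac pullR t := apply: esym; pull t; apply: esym.
Ltac peel := apply: eq_tlift => ? ?.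

Ltac side := first [assumption | solve [lin] | solve [auto 2]].
Tactic Notation "rw" uconstr(e) := rewrite e; [ | side ..].
Tactic Notation "rwV" uconstr(e) := rewrite -e; [ | side ..].
Tactic Notation "in1" tactic3(tac) :=
  etransitivity; [apply: eq_tlift; intros; cbv beta; tac; reflexivity | cbv beta].
Tactic Notation "in2" tactic3(tac) := in1 (in1 tac).
Tactic Notation "in3" tactic3(tac) := in1 (in1 (in1 tac)).

(** * Hopf algebras *)

Section Hopf.
Variables (K : fieldType) (H : algType K) (hopf : hopf_algebra H).
Local Notation D := (comul hopf).
Local Notation S := (antipode hopf).
Local Notation eps := (counit hopf).

Lemma lin_comul : lin D. Proof. exact: comul_linear. Qed.
Lemma lin_antipode : lin S. Proof. exact: antipode_linear. Qed.
Lemma lin_counit : lin (eps : H -> K^o). Proof. exact: counit_linear. Qed.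

Local Hint Resolve lin_comul lin_antipode lin_counit : linbase.

(** Tested against a trilinear [F], the axiom can be rewritten inside any Sweedler sum; the suffix
    [F] marks this form here and below. [G] is the linear map that [F] induces on H (x) (H (x)
    H). *)
Lemma coassocF (W : lmodType K) (F : H -> H -> H -> W) h :
  (forall b c, lin (fun a => F a b c)) -> (forall a c, lin (fun b => F a b c)) ->
  (forall a b, lin (fun c => F a b c)) ->
  \osum_(a, c <- D h) \osum_(a1, a2 <- D a) F a1 a2 c =
  \osum_(a, c <- D h) \osum_(c1, c2 <- D c) F a c1 c2.
Proof.
move=> F1 F2 F3.
pose G (t : H \ox (H \ox H)) := \osum_(a, b <- t) \osum_(c, d <- b) F a c d.
transitivity (G (tassoc (tmap D id (D h)))).
  by apply: esym; rewrite /G /tassoc /tmap; nrm idtac.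
by rewrite comulA /G /tmap; nrm idtac.
Qed.

Lemma counitlF (W : lmodType K) (F : H -> W) h : lin F ->
  \osum_(a, b <- D h) (eps a *: F b) = F h.
Proof.
move=> lF; rewrite -[in RHS](counitl hopf h).
by nrmR ltac:(rewrite (linZ _ _ lF)).
Qed.
Lemma counitrF (W : lmodType K) (F : H -> W) h : lin F ->
  \osum_(a, b <- D h) (eps b *: F a) = F h.
Proof.
move=> lF; rewrite -[in RHS](counitr hopf h).
by nrmR ltac:(rewrite (linZ _ _ lF)).
Qed.
Lemma antipodelF (W : lmodType K) (F : H -> W) h : lin F ->
  \osum_(a, b <- D h) F (S a * b) = eps h *: F 1.
Proof.
move=> lF; rewrite -(linZ _ _ lF) -(antipodel hopf h).
by nrmR idtac.
Qed.
Lemma antipoderF (W : lmodType K) (F : H -> W) h : lin F ->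
  \osum_(a, b <- D h) F (a * S b) = eps h *: F 1.
Proof.
move=> lF; rewrite -(linZ _ _ lF) -(antipoder hopf h).
by nrmR idtac.
Qed.

(** Both sides are convolution inverses of the product H (x) H -> H, one from the left and one from
    the right; [X] is the triple convolution, collapsed in the two possible ways. *)
Lemma antipodeM g h : S (g * h) = S h * S g.
Proof.
pose X := \osum_(g1, g' <- D g) \osum_(g2, g3 <- D g') \osum_(h1, h' <- D h)
  \osum_(h2, h3 <- D h') (S (g1 * h1) * (g2 * h2 * S h3 * S g3)).
transitivity X.
  apply: esym; rewrite /X.
  transitivity (\osum_(g1, g' <- D g) \osum_(g2, g3 <- D g') (S (g1 * h) * (g2 * S g3))).
    apply: eq_tlift => g1 g'; apply: eq_tlift => g2 g3.
    rewrite -(counitrF (F := fun x => S (g1 * x) * (g2 * S g3))); last lin.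
    apply: eq_tlift => h1 h'.
    rewrite -[g2 in RHS]mulr1 -(antipoderF (F := fun x => S (g1 * h1) * (g2 * x * S g3)));
        last lin.
    by apply: eq_tlift => h2 h3; rewrite !mulrA.
  rewrite -(counitrF (F := fun x => S (x * h))); last lin.
  apply: eq_tlift => g1 g'.
  by rewrite (antipoderF (F := fun x => S (g1 * h) * x)) ?mulr1 //; lin.
(* Rebracketed so that now S(g_1 h_1) g_2 h_2 collapses to counits. *)
rewrite /X -coassocF; [|lin..].
transitivity (\osum_(g', g3 <- D g) \osum_(h', h3 <- D h) ((eps g' * eps h') *: (S h3 * S g3))).
  apply: eq_tlift => g' g3.
  in1 (rwV coassocF).
  pull (D h); apply: eq_tlift => h' h3.
  rewrite -counitM -[S h3]mul1r -[_ *: _](antipodelF (F := fun x => x * S h3 * S g3)) ?comulM;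
      last lin.
  by apply: esym; nrmL idtac; do 2 peel; rewrite ?mul1r !mulrA.
have -> : S h * S g = \osum_(g', g3 <- D g) (eps g' *: (S h * S g3)).
  by rewrite (counitlF (F := fun x => S h * S x)) //; lin.
apply: eq_tlift => g' g3.
rewrite -(counitlF (F := fun x => S x * S g3) h); last lin.
by rewrite -tlift_scale; apply: eq_tlift => h' h3; rewrite scalerA.
Qed.

Lemma antipode1 : S 1 = 1.
Proof.
have := antipodel hopf 1; rewrite comul1 tlift_pure; last lin.
by rewrite mulr1 counit1 scale1r.
Qed.

Lemma cancelSl (W : lmodType K) (F : H -> H -> W) h :
  (forall b, lin (fun a => F a b)) -> (forall a, lin (fun b => F a b)) ->
  \osum_(a, c <- D h) \osum_(a1, a2 <- D a) F a1 (S a2 * c) = F h 1.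
Proof.
move=> F1 F2; rw coassocF.
in1 (rewrite (antipodelF (F := fun x => _ x)); last lin).
by rewrite (counitrF (F := fun x => F x 1)).
Qed.

(** The same argument in Hom(H, H (x) H): both sides are convolution inverses of the coproduct, and
    [X] is the triple convolution. *)
Lemma comul_antipode h : D (S h) = \osum_(a, b <- D h) (S b \ox S a).
Proof.
pose X := \osum_(h1, h' <- D h) \osum_(p, q <- D h') \osum_(p1, p2 <- D p)
  \osum_(q1, q2 <- D q) \osum_(a, b <- D (S h1)) ((a * p1 * S q2) \ox (b * p2 * S q1)).
transitivity X.
  rewrite -[D (S h)](counitrF (F := fun x => D (S x))); last lin.
  apply: eq_tlift => h1 h'; apply: esym.
  transitivity (\osum_(a, b <- D (S h1)) (eps h' *: (a \ox b))); last first.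
    by rewrite tlift_scale tlift_id.
  pull (D (S h1)); apply: eq_tlift => a b.
  rewrite coassocF; [|lin..].
  in1 (rwV coassocF).
  transitivity (\osum_(p1, p' <- D h') \osum_(p2, q2 <- D p') (eps p2 *: ((a * p1 * S q2) \ox
      b))).
    do 2 peel; rewrite -[b in RHS]mulr1 -(antipoderF (F := fun x => _ \ox (b * x))); last lin.
    by peel; rewrite mulrA.
  transitivity (\osum_(p1, p' <- D h') ((a * p1 * S p') \ox b)).
    by peel; rewrite (counitlF (F := fun x => (_ * S x) \ox b)) //; lin.
  rewrite -[a in RHS]mulr1 -(antipoderF (F := fun x => (a * x) \ox b)); last lin.
  by peel; rewrite mulrA.
rewrite /X -coassocF; [|lin..].
rewrite -(counitlF (F := fun x => \osum_(a, b <- D x) (S b \ox S a))); last lin.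
apply: eq_tlift => h' q; pull (D q).
rewrite -tlift_scale; apply: eq_tlift => q1 q2.
(* [G] is right multiplication by S(q_2) (x) S(q_1); its argument is the coproduct applied to the
   antipode axiom. *)
pose G (t : H \ox H) := \osum_(a, b <- t) ((a * S q2) \ox (b * S q1)).
have lG : lin G by rewrite /G; lin.
transitivity (G (D ((eps h')%:A))); last first.
  rewrite (linZ _ _ (@lin_comul)) comul1 (linZ _ _ lG) /G tlift_pure; last lin.
  by rewrite !mul1r.
rewrite -antipodel (app_tlift _ _ (@lin_comul)) (app_tlift _ _ lG).
apply: eq_tlift => h1 p; rewrite comulM /G; apply: esym; nrmL idtac.
by rewrite tlift_exch.
Qed.
End Hopf.

#[export] Hint Resolve lin_comul lin_antipode lin_counit : linbase.

(** * Yetter-Drinfeld modules *)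

Section YD.
Variables (K : fieldType) (H : algType K) (hopf : hopf_algebra H).
Local Notation D := (comul hopf).
Local Notation eps := (counit hopf).
Implicit Types U V W X : lmodType K.

(** The linearity half of the Yetter-Drinfeld axioms, which concerns the structure as a whole; the
    other half is checked vector by vector in [yd_at]. *)
Definition hlin V (Y : hstruct H V) : Prop :=
  [/\ forall h, lin (act Y h), forall v, lin ((act Y)^~ v) & lin (coact Y)].

(** The vectors satisfying the axioms form a subspace and are preserved by morphisms, so for tensor
    products and for T(V) it suffices to treat pure tensors and words. *)
Record yd_at V (Y : hstruct H V) (v : V) : Prop := YdAt {
  at1 : act Y 1 v = v;
  atM : forall g h, act Y (g * h) v = act Y g (act Y h v);
  atA : tassoc (tmap D id (coact Y v)) = tmap id (coact Y) (coact Y v);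
  at_counit : \osum_(a, w <- coact Y v) (eps a *: w) = v;
  at_compat : forall h,
    \osum_(h1, h2 <- D h) \osum_(a, v0 <- coact Y v) ((h1 * a) \ox act Y h2 v0) =
    \osum_(h1, h2 <- D h) \osum_(a, v0 <- coact Y (act Y h1 v)) ((a * h2) \ox v0)
}.

Lemma yd_atP V (Y : hstruct H V) :
  yetter_drinfeld hopf Y <-> hlin Y /\ forall v, yd_at Y v.
Proof.
split=> [[[b1 b2] ? ? ? ? ? ?]|[[? ? ?] y]]; first by split=> // v; split.
by split=> //; try (by split); move=> *; apply y.
Qed.

Lemma yd_hlin V (Y : hstruct H V) : yetter_drinfeld hopf Y -> hlin Y.
Proof. by case/yd_atP. Qed.

Section Pointwise.
Variables (V : lmodType K) (Y : hstruct H V).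
Hypothesis lY : hlin Y.

Lemma coactAF W (F : H -> H -> V -> W) v : yd_at Y v ->
  (forall b c, lin (fun a => F a b c)) -> (forall a c, lin (fun b => F a b c)) ->
  (forall a b, lin (fun c => F a b c)) ->
  \osum_(a, v0 <- coact Y v) \osum_(a1, a2 <- D a) F a1 a2 v0 =
  \osum_(a, v0 <- coact Y v) \osum_(b, v1 <- coact Y v0) F a b v1.
Proof.
move=> Yv F1 F2 F3; have [? ? ?] := lY.
pose G (t : H \ox (H \ox V)) := \osum_(a, b <- t) \osum_(c, d <- b) F a c d.
transitivity (G (tassoc (tmap D id (coact Y v)))).
  by apply: esym; rewrite /G /tassoc /tmap; nrm idtac.
by rewrite atA // /G /tmap; nrm idtac.
Qed.

Lemma coact_counitF W (F : V -> W) v : yd_at Y v -> lin F ->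
  \osum_(a, v0 <- coact Y v) (eps a *: F v0) = F v.
Proof.
move=> Yv lF; have [? ? ?] := lY; rewrite -[in RHS](at_counit Yv).
by nrmR ltac:(rewrite (linZ _ _ lF)).
Qed.

Lemma compatF W (F : H -> V -> W) h v : yd_at Y v ->
  (forall b, lin (fun a => F a b)) -> (forall a, lin (fun b => F a b)) ->
  \osum_(h1, h2 <- D h) \osum_(a, v0 <- coact Y v) F (h1 * a) (act Y h2 v0) =
  \osum_(h1, h2 <- D h) \osum_(a, v0 <- coact Y (act Y h1 v)) F (a * h2) v0.
Proof.
move=> Yv F1 F2; have [? ? ?] := lY.
have := congr1 (tlift F) (at_compat Yv h) => e.
etransitivity; [|etransitivity; [exact: e|]]; last by nrm idtac.
by apply: esym; nrm idtac.
Qed.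

End Pointwise.

Section Span.
Variables (V : lmodType K) (Y : hstruct H V).
Hypothesis lY : hlin Y.

Lemma yd_at_lin a u v : yd_at Y u -> yd_at Y v -> yd_at Y (a *: u + v).
Proof.
have [? ? ?] := lY => -[u1 uM uA uC uY] [v1 vM vA vC vY]; split.
- by rewrite (_ : lin (act Y 1)) // u1 v1.
- move=> g h; rewrite (_ : lin (act Y (g * h))) // uM vM.
  by rewrite -(_ : lin (fun x => act Y g (act Y h x))) //; lin.
- have l1 : lin (fun x => tassoc (tmap D id (coact Y x))) by rewrite /tassoc /tmap; lin.
  have l2 : lin (fun x => tmap id (coact Y) (coact Y x)) by rewrite /tmap; lin.
  by rewrite l1 l2 uA vA.
- have l1 : lin (fun x => \osum_(a, w <- coact Y x) (eps a *: w)) by lin.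
  by rewrite l1 uC vC.
move=> h.
have l1 : lin (fun x => \osum_(h1, h2 <- D h) \osum_(a, v0 <- coact Y x) ((h1 * a) \ox act Y h2
    v0)) by lin.
have l2 : lin (fun x => \osum_(h1, h2 <- D h) \osum_(a, v0 <- coact Y (act Y h1 x)) ((a * h2)
    \ox v0)) by lin.
by rewrite l1 l2 uY vY.
Qed.

Lemma yd_at0 : yd_at Y 0.
Proof.
have [? ? ?] := lY; split.
- by rewrite lin0.
- by move=> g h; rewrite !lin0.
- have l1 : lin (fun x => tassoc (tmap D id (coact Y x))) by rewrite /tassoc /tmap; lin.
  have l2 : lin (fun x => tmap id (coact Y) (coact Y x)) by rewrite /tmap; lin.
  by rewrite (lin0 l1) (lin0 l2).
- have l1 : lin (fun x => \osum_(a, w <- coact Y x) (eps a *: w)) by lin.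
  by rewrite (lin0 l1).
move=> h.
have l1 : lin (fun x => \osum_(h1, h2 <- D h) \osum_(a, v0 <- coact Y x) ((h1 * a) \ox act Y h2
    v0)) by lin.
have l2 : lin (fun x => \osum_(h1, h2 <- D h) \osum_(a, v0 <- coact Y (act Y h1 x)) ((a * h2)
    \ox v0)) by lin.
by rewrite (lin0 l1) (lin0 l2).
Qed.

Lemma yd_at_sum I (r : seq I) (c : I -> K) (u : I -> V) :
  (forall i, yd_at Y (u i)) -> yd_at Y (\sum_(i <- r) c i *: u i).
Proof.
move=> yu; elim: r => [|i r IH]; first by rewrite big_nil; apply: yd_at0.
by rewrite big_cons; apply: yd_at_lin.
Qed.

End Span.

(** Meant for the concatenation V (x) T(V) -> T(V), which carries the axioms from a word to a longer
    one. *)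
Lemma yd_at_map U V (Y : hstruct H U) (Z : hstruct H V) (f : U -> V) u :
  hlin Y -> hlin Z -> yd_morphism Y Z f -> yd_at Y u -> yd_at Z (f u).
Proof.
move=> [? ? ?] [? ? ?] [lf fA fC] [u1 uM uA uC uY].
have {}lf : lin f by [].
split.
- by rewrite -fA u1.
- by move=> g h; rewrite -!fA uM.
- pose G (t : H \ox (H \ox U)) : H \ox (H \ox V) := tmap id (tmap id f) t.
  transitivity (G (tassoc (tmap D id (coact Y u)))).
    rewrite fC /G /tassoc /tmap; nrmL idtac.
    by apply: esym; nrm idtac.
  rewrite uA fC /G /tmap; nrmL idtac; apply: esym.
  by nrm ltac:(rewrite fC /tmap).
- rewrite -[in RHS]uC fC /tmap; nrmL idtac; apply: esym.
  by nrm ltac:(rewrite (linZ _ _ lf)).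
move=> h; have := congr1 (tmap id f) (uY h); rewrite /tmap => e.
etransitivity; [|etransitivity; [exact: e|]].
  rewrite fC /tmap; nrmL ltac:(rewrite -fA); apply: esym.
  by nrm idtac.
nrmL idtac; apply: esym.
by nrm ltac:(rewrite -fA fC /tmap).
Qed.

(** * Tensor products of Yetter-Drinfeld modules *)

Section TensYD.
Variables (U V : lmodType K) (Y : hstruct H U) (Z : hstruct H V).
Hypotheses (lY : hlin Y) (lZ : hlin Z).
Local Notation YZ := (yd_tens hopf Y Z).

Lemma act_tensE h u v : act YZ h (u \ox v) = \osum_(h1, h2 <- D h) (act Y h1 u \ox act Z h2 v).
Proof. by have [? ? ?] := lY; have [? ? ?] := lZ; rewrite /yd_tens /tmap /=; nrm idtac. Qed.

Lemma coact_tensE u v : coact YZ (u \ox v) =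
  \osum_(a, u0 <- coact Y u) \osum_(b, v0 <- coact Z v) ((a * b) \ox (u0 \ox v0)).
Proof. by have [? ? ?] := lY; have [? ? ?] := lZ; rewrite /yd_tens /=; nrm idtac. Qed.

Lemma hlin_tens : hlin YZ.
Proof.
have [? ? ?] := lY; have [? ? ?] := lZ.
by split=> [h|v|]; rewrite /yd_tens /tmap /=; lin.
Qed.

Lemma yd_at_tens u v : yd_at Y u -> yd_at Z v -> yd_at YZ (u \ox v).
Proof.
move=> Yu Zv; have [? ? ?] := lY; have [? ? ?] := lZ; have [? ? ?] := hlin_tens.
have [u1 uM _ uC _] := Yu; have [v1 vM _ vC _] := Zv.
split.
- by rewrite act_tensE comul1; nrmL idtac; rewrite u1 v1.
- move=> g h; rewrite !act_tensE comulM; nrmL idtac; apply: esym.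
  nrmL ltac:(rewrite act_tensE); pull (D g).
  by do 2 peel; rewrite uM vM.
- rewrite coact_tensE /tassoc /tmap; nrmL ltac:(rewrite comulM).
  apply: esym; nrmL ltac:(rewrite coact_tensE); apply: esym.
  etransitivity; [apply: eq_tlift => a u0; pull (D a); reflexivity|].
  rw (coactAF lY); apply: eq_tlift => a u0; pullR (coact Y u0); apply: eq_tlift => b w.
  by rw (coactAF lZ).
- rewrite coact_tensE; nrmL ltac:(rewrite counitM).
  rewrite -[u in RHS]uC -[v in RHS]vC; nrmR idtac.
  by do 2 peel; rewrite pureZl pureZr scalerA.
(* Starting from the side with the coaction of h_1 u (x) h_2 v, multiplied by h_3: compatibility in
   [Z] turns (h_2 v)_{-1} h_3 into h_2 v_{-1}, and this puts h_2 next to (h_1 u)_{-1}, where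
   compatibility in [Y] applies. *)
move=> h; apply: esym.
etransitivity; [apply: eq_tlift => h' h3; rewrite act_tensE;
    nrm ltac:(rewrite coact_tensE)|cbv beta].
rw coassocF.
etransitivity; [apply: eq_tlift => h1 h'; pull (coact Y (act Y h1 u));
    apply: eq_tlift => a u0|cbv beta].
  in2 (rewrite -mulrA).
  rwV (compatF (F := fun x y => (a * x) \ox (u0 \ox y)) lZ).
  by reflexivity.
etransitivity; [apply: eq_tlift => h1 h'; pull (D h'); reflexivity|cbv beta].
rwV coassocF.
etransitivity; [apply: eq_tlift => h1 h'|cbv beta].
  in3 (rewrite mulrA).
  rwV (compatF (F := fun x y => \osum_(b, v0 <- coact Z v) ((x * b) \ox (y \ox act Z h' v0)))
      lY).
  by reflexivity.
rw coassocF; apply: eq_tlift => h1 h'; rewrite coact_tensE; apply: esym.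
nrmL ltac:(rewrite act_tensE); apply: esym.
by pullR (D h'); do 3 peel; rewrite mulrA.
Qed.

Lemma yd_tensP : yetter_drinfeld hopf Y -> yetter_drinfeld hopf Z -> yetter_drinfeld hopf YZ.
Proof.
move=> /yd_atP[_ Yu] /yd_atP[_ Zv]; apply/yd_atP; split; first exact: hlin_tens.
move=> t; rewrite (tens_span t); apply: yd_at_sum; first exact: hlin_tens.
by move=> p; apply: yd_at_tens.
Qed.

End TensYD.

End YD.

(** * The natural braiding *)

Section Braiding.
Variables (K : fieldType) (H : algType K) (hopf : hopf_algebra H).
Local Notation D := (comul hopf).
Local Notation S := (antipode hopf).
Local Notation eps := (counit hopf).
Variables (V : lmodType K) (Y : hstruct H V).
Hypothesis Y_yd : yetter_drinfeld hopf Y.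

Let lY : hlin Y := yd_hlin Y_yd.
Let Yat : forall v, yd_at hopf Y v. Proof. by case/yd_atP: Y_yd. Qed.
Let lA2 v : lin ((act Y)^~ v). Proof. by case: lY. Qed.

Lemma lin_yd_braiding : lin (yd_braiding Y).
Proof. by rewrite /yd_braiding; lin. Qed.
Local Hint Resolve lin_yd_braiding : linbase.

Lemma yd_braidingE v w : yd_braiding Y (v \ox w) = \osum_(a, v0 <- coact Y v) (act Y a w \ox
    v0).
Proof. by rewrite /yd_braiding; nrm idtac. Qed.

Lemma yd_braiding_nat f t : yd_morphism Y Y f ->
  yd_braiding Y (tmap f f t) = tmap f f (yd_braiding Y t).
Proof.
case=> lf fA fC; have {}lf : lin f by [].
move: t; apply: tens_ext; rewrite /tmap; [lin..|].
move=> v w; nrmL ltac:(rewrite ?yd_braidingE ?fC /tmap); apply: esym.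
by nrm ltac:(rewrite ?yd_braidingE ?fA).
Qed.

Lemma sigma1E (t : V \ox V) w : sigma1 (yd_braiding Y) (t \ox w) = yd_braiding Y t \ox w.
Proof. by rewrite /sigma1 /tmap; nrm idtac. Qed.

Lemma lin_sigma1 : lin (sigma1 (yd_braiding Y)).
Proof. by rewrite /sigma1 /tmap; lin. Qed.

Lemma sigma2E u v w : sigma2 (yd_braiding Y) (u \ox v \ox w) =
  \osum_(a, v0 <- coact Y v) (u \ox act Y a w \ox v0).
Proof. by rewrite /sigma2 /tmap /tassoc /tassocV; nrm ltac:(rewrite yd_braidingE). Qed.

Lemma lin_sigma2 : lin (sigma2 (yd_braiding Y)).
Proof. by rewrite /sigma2 /tmap /tassoc /tassocV; lin. Qed.
Local Hint Resolve lin_sigma1 lin_sigma2 : linbase.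

(** On u (x) v (x) w, coassociativity and the module law reduce both sides to sums whose only
    difference is the Yetter-Drinfeld compatibility for v, with h the coaction component of u. *)
Lemma yd_ybe t : sigma1 (yd_braiding Y) (sigma2 (yd_braiding Y) (sigma1 (yd_braiding Y) t)) =
  sigma2 (yd_braiding Y) (sigma1 (yd_braiding Y) (sigma2 (yd_braiding Y) t)).
Proof.
move: t; apply: tens3_ext; [lin..|move=> u v w].
nrmL ltac:(rewrite ?sigma1E ?sigma2E ?yd_braidingE).
apply: esym; nrmL ltac:(rewrite ?sigma1E ?sigma2E ?yd_braidingE).
etransitivity; [apply: eq_tlift => a v0|].
  rwV (coactAF (hopf := hopf) (F := fun b c u1 => act Y b (act Y a w) \ox act Y c v0 \ox u1)
      lY).
  reflexivity.
pull (coact Y u); apply: esym.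
etransitivity; [apply: eq_tlift => a u0; pull (coact Y u0); reflexivity|].
rwV (coactAF (hopf := hopf) (F := fun a b u1 => \osum_(c, v0 <- coact Y (act Y a v)) (act Y c
    (act Y b w) \ox v0 \ox u1)) lY).
apply: eq_tlift => a u0; apply: esym; rewrite tlift_exch.
etransitivity; [apply: eq_tlift => b c; apply: eq_tlift => d v0; rewrite -(atM (Yat _));
    reflexivity|].
rw (compatF (F := fun x y => act Y x w \ox y \ox u0) lY).
by do 2 peel; rewrite (atM (Yat _)).
Qed.

(** The inverse is w (x) v |-> v_0 (x) S^{-1}(v_{-1}) w. It needs the identities T(h_2) h_1 = eps(h)
    1 = h_2 T(h_1) for the inverse T of S; applying the antimultiplicative S turns them into the
    antipode axioms. *)
Lemma yd_braiding_bij : bijective S -> bijective (yd_braiding Y).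
Proof.
case=> T ST TS.
have lT : lin T by move=> a x y; apply: (can_inj ST); rewrite (@lin_antipode _ _ hopf) !TS.
have TM g h : T (g * h) = T h * T g by apply: (can_inj ST); rewrite antipodeM !TS.
have Tl h : \osum_(a, b <- D h) (T b * a) = (eps h)%:A.
  apply: (can_inj ST); rewrite (app_tlift _ _ (@lin_antipode _ _ hopf)) linZ ?antipode1;
      last exact: lin_antipode.
  by rewrite -antipodel; peel; rewrite antipodeM TS.
have Tr h : \osum_(a, b <- D h) (b * T a) = (eps h)%:A.
  apply: (can_inj ST); rewrite (app_tlift _ _ (@lin_antipode _ _ hopf)) linZ ?antipode1;
      last exact: lin_antipode.
  by rewrite -antipoder; peel; rewrite antipodeM TS.
pose d (t : V \ox V) : V \ox V := \osum_(w, v <- t) \osum_(a, v0 <- coact Y v) (v0 \ox act Y (T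
    a) w).
have ld : lin d by rewrite /d; lin.
exists d; apply: tens_ext; try lin; move=> v w.
  rewrite yd_braidingE; nrmL ltac:(rewrite /d).
  rwV (coactAF (hopf := hopf) (F := fun a b v1 => v1 \ox act Y (T b) (act Y a w)) lY).
  rewrite -[v in RHS](at_counit (Yat v)); nrmR idtac; apply: eq_tlift => a v0.
  rewrite pureZl -[w in RHS](at1 (Yat w)) -pureZr -(linZ _ _ (lA2 w)) -Tl.
  nrmR idtac.
  by peel; rewrite (atM (Yat w)).
rewrite /d; nrmL ltac:(rewrite ?yd_braidingE).
rwV (coactAF (hopf := hopf) (F := fun a b v1 => act Y b (act Y (T a) v) \ox v1) lY).
rewrite -[w in RHS](at_counit (Yat w)); nrmR idtac; apply: eq_tlift => a v0.
rewrite pureZr -[v in RHS](at1 (Yat v)) -pureZl -(linZ _ _ (lA2 v)) -Tr.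
nrmR idtac.
by peel; rewrite (atM (Yat v)).
Qed.

Lemma yd_braiding_braiding : bijective S -> braiding (yd_braiding Y).
Proof.
by move=> bS; split; [exact: lin_yd_braiding|exact: yd_braiding_bij|exact: yd_ybe].
Qed.

(** Moving a product to the right through the braiding involves its coaction, moving it to the left
    the action on it, so each compatibility unfolds to one of the two hypotheses. *)
Lemma yd_braided_algebra (m : V -> V -> V) : bijective S -> is_algebra m ->
  (forall h x y, act Y h (m x y) = \osum_(h1, h2 <- D h) m (act Y h1 x) (act Y h2 y)) ->
  (forall x y, coact Y (m x y) =
    \osum_(a, x0 <- coact Y x) \osum_(b, y0 <- coact Y y) ((a * b) \ox m x0 y0)) ->
  braided_algebra m (yd_braiding Y).
Proof.
move=> bS [bm mA] mact mcoact; split=> //; first exact: yd_braiding_braiding.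
  have [lm1 lm2] : (forall y, lin (m^~ y)) /\ (forall x, lin (m x)) by [].
  apply: tens3_ext; rewrite /tmap /tassoc; [lin..|move=> x y z].
  nrmL ltac:(rewrite ?sigma1E ?sigma2E ?yd_braidingE); apply: esym.
  nrmL ltac:(rewrite ?yd_braidingE ?mcoact).
  pull (coact Y y); do 2 peel; rewrite (atM (Yat z)) //.
have [lm1 lm2] : (forall y, lin (m^~ y)) /\ (forall x, lin (m x)) by [].
apply: tens3_ext; rewrite /tmap /tassoc; [lin..|move=> x y z].
nrmL ltac:(rewrite ?sigma1E ?sigma2E ?yd_braidingE); apply: esym.
nrmL ltac:(rewrite ?yd_braidingE ?mact).
by rw (coactAF lY).
Qed.

End Braiding.

(** * The Hopf algebra as a Yetter-Drinfeld module over itself *)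

Section Adjoint.
Variables (K : fieldType) (H : algType K) (hopf : hopf_algebra H).
Local Notation D := (comul hopf).
Local Notation S := (antipode hopf).

Definition adjoint : hstruct H H :=
  HStruct (fun g k => \osum_(g1, g2 <- D g) (g1 * k * S g2)) D.

(** In the compatibility condition, the coproduct of h_1 v S(h_2) times h_3 unfolds to h_1 v_1
    S(h_4) h_5 (x) h_2 v_2 S(h_3), because S reverses coproducts; [cancelSl] removes S(h_4) h_5. *)
Lemma adjoint_yd : yetter_drinfeld hopf adjoint.
Proof.
split=> [|v|g h v||v|v|h v]; rewrite /adjoint /=.
- lin.
- by rewrite comul1; nrmL idtac; rewrite antipode1 mul1r mulr1.
- rewrite comulM; nrmL idtac; apply: esym; nrmL idtac.
  by do 2 peel; rewrite antipodeM !mulrA.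
- exact: lin_comul.
- exact: comulA.
- exact: counitl.
apply: esym; nrmL ltac:(rewrite ?comulM ?comul_antipode).
rw coassocF.
in2 (pull (D v); reflexivity).
etransitivity; [apply: eq_tlift => h1 h'|].
  pull (D v); apply: eq_tlift => v1 v2.
  etransitivity; [apply: eq_tlift => h2 h3; pull (D h2); reflexivity|].
  in2 (etransitivity; [apply: eq_tlift; intros; rewrite -mulrA; reflexivity|]).
    rw (cancelSl hopf (F := fun x y => \osum_(u, v0 <- D h1) ((u * v1 * y) \ox (v0 * v2 * S
        x))) h').
  reflexivity.
etransitivity; [apply: eq_tlift => h1 h'; pull (D h1); reflexivity|].
rw coassocF; apply: eq_tlift => h1 h'; apply: esym; nrmL idtac.
by pull (D h'); do 2 peel; rewrite mulr1.
Qed.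
End Adjoint.

(** * The tensor algebra of a Yetter-Drinfeld module *)

Section Talg.
Variables (K : fieldType) (V : lmodType K).
Implicit Types (x y z : talg V) (s t : seq V) (v : V) (W : lmodType K).

Local Notation "[ 'w' v ]" := (word [:: v]) (format "[ 'w'  v ]").
Local Notation one := (word [::] : talg V).

Lemma lin_wlift W (f : seq V -> W) : is_multilinear f -> lin (wlift f).
Proof. exact: wlift_linear. Qed.

Lemma tcat_multil y : is_multilinear (fun s => wlift (fun t => word (s ++ t)) y : talg V).
Proof.
move=> s t; change (lin (fun v => wlift (fun t' => word ((s ++ v :: t) ++ t') : talg V) y)).
apply: lin_wliftr => u; move=> a v v'; rewrite -!catA /=.
exact: (@word_multilinear K V s (t ++ u)).
Qed.

Lemma tcat_multir s : is_multilinear (fun t => word (s ++ t) : talg V).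
Proof. by move=> t u a v v'; rewrite !catA; apply: (@word_multilinear K V). Qed.

Lemma lin_tcatl y : lin (fun x => tcat x y).
Proof. exact: lin_wlift (tcat_multil y). Qed.

Lemma lin_tcatr x : lin (fun y => tcat x y).
Proof. by apply: lin_wliftr => s; apply: lin_wlift; apply: tcat_multir. Qed.
Local Hint Resolve lin_tcatl lin_tcatr : linbase.

Lemma tcat_word s t : tcat (word s) (word t) = word (s ++ t) :> talg V.
Proof. by rewrite /tcat wlift_word ?wlift_word //; [exact: tcat_multir|exact: tcat_multil]. Qed.

Lemma tcat1x x : tcat one x = x.
Proof. by move: x; apply: talg_ext => [||s]; [lin..|rewrite tcat_word]. Qed.

Lemma tcatx1 x : tcat x one = x.
Proof. by move: x; apply: talg_ext => [||s]; [lin..|rewrite tcat_word cats0]. Qed.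

Lemma tcatA x y z : tcat x (tcat y z) = tcat (tcat x y) z.
Proof.
move: x; apply: talg_ext => [||s]; [lin..|].
move: y; apply: talg_ext => [||t]; [lin..|].
move: z; apply: talg_ext => [||u]; [lin..|].
by rewrite !tcat_word catA.
Qed.

Lemma word_cons v s : word (v :: s) = tcat [w v] (word s) :> talg V.
Proof. by rewrite tcat_word. Qed.

Lemma word_rcons s v : word (rcons s v) = tcat (word s) [w v] :> talg V.
Proof. by rewrite tcat_word cats1. Qed.

Lemma counit_multi : is_multilinear (fun s : seq V => (nilp s)%:R : K^o).
Proof. by move=> [|u s] t a v v'; rewrite /= scaler0 addr0. Qed.

Lemma lin_counitT : lin (@counitT K V : talg V -> K^o).
Proof. exact: lin_wlift counit_multi. Qed.

Lemma counitT_word s : counitT (word s : talg V) = (nilp s)%:R.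
Proof. by rewrite /counitT wlift_word //; exact: counit_multi. Qed.

Lemma homog_multi n : is_multilinear (fun s => if size s == n then word s else 0 : talg V).
Proof.
move=> s t a v v'; rewrite !size_cat /=; case: eqP => _.
  exact: (@word_multilinear K V).
by rewrite scaler0 addr0.
Qed.

Lemma lin_homog n : lin (@homog K V n).
Proof. exact: lin_wlift (@homog_multi n). Qed.

Lemma homog_word n s : homog n (word s : talg V) = if size s == n then word s else 0.
Proof. by rewrite /homog wlift_word //; exact: homog_multi. Qed.

Lemma take_drop_multi i : is_multilinear (fun s => word (take i s) \ox word (drop i s) : talg V
    \ox talg V).
Proof.
move=> s t; change (lin (fun v => word (take i (s ++ v :: t)) \ox word (drop i (s ++ v :: t)) :
    talg V \ox talg V)).
(* The varying letter sits in the right factor if i <= size s, and in the left one otherwise. *)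
have [le_is|lt_si] := leqP i (size s).
  have tE v : take i (s ++ v :: t) = take i s by rewrite takel_cat.
  have dE v : drop i (s ++ v :: t) = drop i s ++ v :: t.
    rewrite drop_cat; case: ltnP => // le_si; rewrite (drop_oversize le_si).
    by have -> : i = size s; [apply/anti_leq/andP|rewrite subnn].
  move=> a v v'; rewrite !tE !dE; move: a v v'.
  by apply: (@lin_pure2 _ _ _ _ (fun v => word (drop i s ++ v :: t)));
      exact: (@word_multilinear K V).
have tE v : take i (s ++ v :: t) = s ++ v :: take (i - size s).-1 t.
  rewrite take_cat ltnNge (ltnW lt_si) /=; congr cat.
  by have -> : (i - size s = (i - size s).-1.+1)%N by rewrite prednK ?subn_gt0.
have dE v : drop i (s ++ v :: t) = drop (i - size s).-1 t.
  rewrite drop_cat ltnNge (ltnW lt_si) /=.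
  by have -> : (i - size s = (i - size s).-1.+1)%N by rewrite prednK ?subn_gt0.
move=> a v v'; rewrite !tE !dE; move: a v v'.
by apply: (@lin_pure1 _ _ _ _ (fun v => word (s ++ v :: take (i - size s).-1 t)));
    exact: (@word_multilinear K V).
Qed.

Lemma lin_split_at i : lin (@split_at K V i).
Proof. exact: lin_wlift (@take_drop_multi i). Qed.

Lemma split_at_word i s : split_at i (word s : talg V) = word (take i s) \ox word (drop i s).
Proof. by rewrite /split_at wlift_word //; exact: take_drop_multi. Qed.

Lemma deconc_multi :
  is_multilinear (fun s => \sum_(0 <= i < (size s).+1) (word (take i s) \ox word (drop i s)) :
      talg V \ox talg V).
Proof.
move=> s t a v v'; rewrite !size_cat /= scaler_sumr -big_split /=.
by apply: eq_bigr => i _; apply: take_drop_multi.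
Qed.

Lemma lin_deconc : lin (@deconc K V).
Proof. exact: lin_wlift deconc_multi. Qed.
Local Hint Resolve lin_counitT lin_homog lin_split_at lin_deconc : linbase.

Lemma deconc_word s : deconc (word s : talg V) =
  \sum_(0 <= i < (size s).+1) (word (take i s) \ox word (drop i s)).
Proof. by rewrite /deconc wlift_word //; exact: deconc_multi. Qed.

Lemma deconc1 : deconc one = one \ox one.
Proof. by rewrite deconc_word big_nat1. Qed.

Lemma deconc_cons v x : deconc (tcat [w v] x) =
  one \ox tcat [w v] x + \osum_(x1, x2 <- deconc x) (tcat [w v] x1 \ox x2).
Proof.
move: x; apply: talg_ext => [||s]; [lin..|].
rewrite tcat_word /= !deconc_word big_nat_recl //=; congr (_ + _).
rewrite (lin_sum (f := tlift _)) //; last by apply: tlift_linear; lin.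
by apply: eq_bigr => i _; rewrite tlift_pure ?tcat_word //; lin.
Qed.

(** The recursion at the last letter is the one that fits [star_deg], which appends letters on the
    right. *)
Lemma deconc_rcons v x : deconc (tcat x [w v]) =
  tcat x [w v] \ox one + \osum_(x1, x2 <- deconc x) (x1 \ox tcat x2 [w v]).
Proof.
move: x; apply: talg_ext => [||s]; [lin..|].
rewrite tcat_word cats1 /= !deconc_word size_rcons big_nat_recr //= addrC; congr (_ + _).
  by rewrite take_oversize ?drop_oversize ?size_rcons.
rewrite (lin_sum (f := tlift _)) //; last by apply: tlift_linear; lin.
rewrite !big_nat; apply: eq_bigr => i; rewrite ltnS => /andP[_ le_is].
rewrite tlift_pure ?tcat_word ?cats1 //; last lin.
rewrite -!cats1 takel_cat // drop_cat; case: (ltnP i (size s)) => [//|le_si].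
have -> : i = size s by apply/eqP; rewrite eqn_leq le_is le_si.
by rewrite subnn drop_size.
Qed.

Lemma talg_ind W (f g : talg V -> W) : lin f -> lin g -> f one = g one ->
  (forall v s, f (word s) = g (word s) -> f (tcat [w v] (word s)) = g (tcat [w v] (word s))) ->
  f =1 g.
Proof.
move=> lf lg fg1 fgS; apply: talg_ext => //.
by elim=> [//|v s IH]; rewrite word_cons; apply: fgS.
Qed.

Lemma deconc1F W (F : talg V -> talg V -> W) : is_bilinear F ->
  \osum_(x1, x2 <- deconc one) F x1 x2 = F one one.
Proof. by move=> bF; rewrite deconc1 tlift_pure. Qed.

Lemma deconc_consF W (F : talg V -> talg V -> W) v x : is_bilinear F ->
  \osum_(x1, x2 <- deconc (tcat [w v] x)) F x1 x2 =
  F one (tcat [w v] x) + \osum_(x1, x2 <- deconc x) F (tcat [w v] x1) x2.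
Proof.
case=> F1 F2; rewrite deconc_cons tliftD // tlift_pure //; congr (_ + _).
have {}F1 : forall y, lin (F^~ y) := F1; have {}F2 : forall y, lin (F y) := F2.
by nrm idtac.
Qed.

Lemma deconc_rconsF W (F : talg V -> talg V -> W) v x : is_bilinear F ->
  \osum_(x1, x2 <- deconc (tcat x [w v])) F x1 x2 =
  F (tcat x [w v]) one + \osum_(x1, x2 <- deconc x) F x1 (tcat x2 [w v]).
Proof.
case=> F1 F2; rewrite deconc_rcons tliftD // tlift_pure //; congr (_ + _).
have {}F1 : forall y, lin (F^~ y) := F1; have {}F2 : forall y, lin (F y) := F2.
by nrm idtac.
Qed.

Lemma deconcA W (F : talg V -> talg V -> talg V -> W) x :
  (forall b c, lin (fun a => F a b c)) -> (forall a c, lin (fun b => F a b c)) ->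
  (forall a b, lin (fun c => F a b c)) ->
  \osum_(a, c <- deconc x) \osum_(a1, a2 <- deconc a) F a1 a2 c =
  \osum_(a, c <- deconc x) \osum_(c1, c2 <- deconc c) F a c1 c2.
Proof.
move=> F1 F2 F3; move: x; apply: talg_ext; [lin..|] => s.
elim: s F F1 F2 F3 => [|v s IH] F F1 F2 F3.
  by rewrite !deconc1F //; lin.
rewrite word_cons !deconc_consF; try lin.
rewrite deconc1F; last lin.
rewrite -addrA; congr (_ + _).
in1 (rewrite deconc_consF; last lin).
by rewrite tlift_add; congr (_ + _); apply: (IH (fun a b c => F (tcat [w v] a) b c)); lin.
Qed.

Lemma homog0E x : homog 0 x = counitT x *: one.
Proof.
move: x; apply: talg_ext => [||s]; [lin| |].
  by apply: (@lin_scalel _ _ _ (@counitT K V)); exact: lin_counitT.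
rewrite homog_word counitT_word.
by case: s => [|v s]; rewrite ?scale1r ?scale0r.
Qed.

Lemma homog0_cons v x : homog 0 (tcat [w v] x) = 0.
Proof.
move: x; apply: talg_ext => [||s]; [lin|exact: lin_const0|].
by rewrite tcat_word homog_word.
Qed.

Lemma homogS_cons n v x : homog n.+1 (tcat [w v] x) = tcat [w v] (homog n x).
Proof.
move: x; apply: talg_ext => [||s]; [lin..|].
rewrite tcat_word !homog_word /= eqSS; case: eqP => _; first by rewrite tcat_word.
by rewrite (lin0 (@lin_tcatr _)).
Qed.

Lemma homog0_rcons v x : homog 0 (tcat x [w v]) = 0.
Proof.
move: x; apply: talg_ext => [||s]; [lin|exact: lin_const0|].
by rewrite tcat_word homog_word size_cat addn1.
Qed.

Lemma homogS_rcons n v x : homog n.+1 (tcat x [w v]) = tcat (homog n x) [w v].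
Proof.
move: x; apply: talg_ext => [||s]; [lin..|].
rewrite tcat_word !homog_word size_cat addn1 eqSS; case: eqP => _; first by rewrite tcat_word.
by rewrite (lin0 (@lin_tcatl _)).
Qed.

Lemma homog_homog m n x : homog m (homog n x) = if m == n then homog n x else 0.
Proof.
case: (m =P n) => [<-|/eqP mn]; move: x; apply: talg_ext => [||s]; try lin;
    try exact: lin_const0.
  by rewrite !homog_word; case: ifP => // e; rewrite ?homog_word ?e // lin0 //;
      exact: lin_homog.
rewrite !homog_word; case: eqP => [e|_]; last by rewrite lin0 //; exact: lin_homog.
by rewrite homog_word e eq_sym (negPf mn).
Qed.

Lemma homog_one n : homog n one = if n == 0%N then one else 0.
Proof. by rewrite homog_word eq_sym. Qed.

(** The counit law, with the degree 0 projection in the role of the counit: its values stay in T(V)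
    and it is handled like any other [homog n]. *)
Lemma deconc_counitlF W (F : talg V -> talg V -> W) x : is_bilinear F ->
  \osum_(x1, x2 <- deconc x) F (homog 0 x1) x2 = F one x.
Proof.
case=> F1 F2; have {}F1 : forall y, lin (F^~ y) := F1; have {}F2 : forall y, lin (F y) := F2.
move: x; apply: talg_ind => [|||v s _]; [lin..| |].
  by rewrite deconc1F ?homog_one //; lin.
rewrite deconc_consF; last lin.
rewrite homog_one tliftE big1 ?addr0 // => p _.
by rewrite homog0_cons (lin0 (F1 _)) scaler0.
Qed.

Lemma deconc_counitrF W (F : talg V -> talg V -> W) x : is_bilinear F ->
  \osum_(x1, x2 <- deconc x) F x1 (homog 0 x2) = F x one.
Proof.
case=> F1 F2; have {}F1 : forall y, lin (F^~ y) := F1; have {}F2 : forall y, lin (F y) := F2.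
move: x; apply: talg_ext => [||s]; [lin..|].
elim/last_ind: s => [|s v _]; first by rewrite deconc1F ?homog_one //; lin.
rewrite word_rcons deconc_rconsF; last lin.
rewrite homog_one tliftE big1 ?addr0 // => p _.
by rewrite homog0_rcons (lin0 (F2 _)) scaler0.
Qed.

End Talg.
#[export] Hint Resolve lin_tcatl lin_tcatr lin_counitT lin_homog lin_split_at lin_deconc :
    linbase.

(** * The Yetter-Drinfeld structure of T(V) *)

Section TalgYD.
Variables (K : fieldType) (H : algType K) (hopf : hopf_algebra H).
Local Notation D := (comul hopf).
Local Notation eps := (counit hopf).
Variables (V : lmodType K) (Y : hstruct H V).
Hypothesis Y_yd : yetter_drinfeld hopf Y.
Local Notation TY := (yd_talg hopf Y).
Local Notation "[ 'w' v ]" := (word [:: v]) (format "[ 'w'  v ]").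
Local Notation one := (word [::] : talg V).

Let lY : hlin Y := yd_hlin Y_yd.
Let Yat : forall v, yd_at hopf Y v. Proof. by case/yd_atP: Y_yd. Qed.

Lemma lin_act_word s : lin (fun h => act_word hopf Y h s).
Proof.
elim: s => [|v s IH] /=; last by lin.
by apply: lin_scalel; apply: lin_counit.
Qed.
Local Hint Resolve lin_act_word : linbase.

Lemma act_word_multi h : is_multilinear (act_word hopf Y h).
Proof.
move=> s t; change (lin (fun v => act_word hopf Y h (s ++ v :: t))).
elim: s h => [|u s IH] h /=; last by lin.
by lin.
Qed.

Lemma coact_word_multi : is_multilinear (coact_word Y).
Proof.
move=> s t; change (lin (fun v => coact_word Y (s ++ v :: t))).
by elim: s => [|u s IH] /=; lin.
Qed.

Lemma hlin_talg : hlin TY.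
Proof.
split=> [h|x|].
- exact: lin_wlift (@act_word_multi h).
- by apply: lin_wliftr => s; apply: lin_act_word.
exact: lin_wlift coact_word_multi.
Qed.

Let lT1 h : lin (act TY h). Proof. by case: hlin_talg. Qed.
Let lT2 v : lin ((act TY)^~ v). Proof. by case: hlin_talg. Qed.
Let lTC : lin (coact TY). Proof. by case: hlin_talg. Qed.

Lemma act_wordE h s : act TY h (word s) = act_word hopf Y h s.
Proof. by rewrite /= wlift_word //; apply: act_word_multi. Qed.

Lemma coact_wordE s : coact TY (word s) = coact_word Y s.
Proof. by rewrite /= wlift_word //; apply: coact_word_multi. Qed.

Lemma act_one h : act TY h one = eps h *: one.
Proof. by rewrite act_wordE. Qed.

Lemma coact_one : coact TY one = 1 \ox one.
Proof. by rewrite coact_wordE. Qed.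

Lemma act_cons h v x : act TY h (tcat [w v] x) =
  \osum_(h1, h2 <- D h) tcat [w act Y h1 v] (act TY h2 x).
Proof.
move: x; apply: talg_ext => [||s]; [lin..|].
by rewrite -word_cons act_wordE; peel; rewrite act_wordE.
Qed.

Lemma coact_cons v x : coact TY (tcat [w v] x) =
  \osum_(a, v0 <- coact Y v) \osum_(b, x0 <- coact TY x) ((a * b) \ox tcat [w v0] x0).
Proof.
move: x; apply: talg_ext => [||s]; [lin..|].
by rewrite -word_cons coact_wordE; peel; rewrite coact_wordE.
Qed.

Lemma act_word1 h v : act TY h [w v] = [w act Y h v].
Proof.
rewrite -[X in act TY h X]tcatx1 act_cons.
rewrite -[in RHS](@counitrF _ _ hopf _ (fun h => [w act Y h v])); last lin.
by peel; rewrite act_one (linZ _ _ (@lin_tcatr _ _ _)) tcatx1.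
Qed.

Lemma coact_word1 v : coact TY [w v] = \osum_(a, v0 <- coact Y v) (a \ox [w v0]).
Proof.
rewrite -[X in coact TY X]tcatx1 coact_cons coact_one.
by nrmL idtac; peel; rewrite mulr1 tcatx1.
Qed.

(** Induction on words: [v :: s] is the image of v (x) s under the concatenation V (x) T(V) -> T(V),
    which is a morphism, so [yd_at_tens] and [yd_at_map] pass from s to [v :: s]. The empty word
    spans the trivial module. *)
Lemma yd_talgP : yetter_drinfeld hopf TY.
Proof.
apply/yd_atP; split; first exact: hlin_talg.
move=> x; rewrite (talg_span x); apply: yd_at_sum; first exact: hlin_talg.
move=> [_ s] /=; elim: s => [|v s IH].
  split=> [|g h|||h].
  - by rewrite act_one counit1 scale1r.
  - by rewrite !act_one counitM linZ // act_one scalerA mulrC.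
  - by rewrite coact_one /tassoc /tmap; nrmL ltac:(rewrite ?comul1); apply: esym;
      nrm ltac:(rewrite ?coact_one).
  - by rewrite coact_one; nrmL idtac; rewrite counit1 scale1r.
  rewrite coact_one.
  transitivity (h \ox one).
    nrmL idtac; rewrite -(counitrF hopf (F := fun h => h \ox one) h); last lin.
    by peel; rewrite mulr1 act_one pureZr.
  apply: esym; rewrite -[RHS](counitlF hopf (F := fun h => h \ox one) h); last lin.
  peel; rewrite act_one linZ // coact_one linZ; last by apply: tlift_linear; lin.
  by rewrite tlift_pure ?mul1r //; lin.
pose f (t : V \ox talg V) : talg V := \osum_(u, y <- t) tcat [w u] y.
have lf : lin f by rewrite /f; lin.
have -> : word (v :: s) = f (v \ox word s) by rewrite /f word_cons; nrmR idtac.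
have [lt1 lt2 lt3] := hlin_tens hopf lY hlin_talg.
apply: (yd_at_map (hlin_tens hopf lY hlin_talg) hlin_talg); last first.
  by apply: yd_at_tens => //; apply: hlin_talg.
split=> //.
  move=> h; apply: tens_ext; [lin..|move=> u y].
  rewrite (act_tensE hopf lY hlin_talg).
  by rewrite /f; nrmL idtac; apply: esym; nrm ltac:(rewrite ?act_cons).
apply: tens_ext; rewrite /tmap; [lin..|move=> u y].
rewrite (coact_tensE hopf lY hlin_talg).
by rewrite /f; nrmL ltac:(rewrite ?coact_cons); apply: esym; nrm idtac.
Qed.

Lemma act_tcat h x y : act TY h (tcat x y) =
  \osum_(h1, h2 <- D h) tcat (act TY h1 x) (act TY h2 y).
Proof.
move: x; apply: talg_ext => [||s]; [lin..|].
elim: s h => [|v s IH] h.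
  rewrite tcat1x -[LHS](counitlF hopf (F := fun h => act TY h y)); last lin.
  by peel; rewrite act_one (linZ _ _ (@lin_tcatl _ _ _)) tcat1x.
rewrite word_cons -tcatA act_cons.
etransitivity; [apply: eq_tlift => h1 h2; rewrite IH; nrm idtac|cbv beta].
rwV coassocF; peel; rewrite act_cons; nrmR idtac.
by peel; rewrite tcatA.
Qed.

Lemma coact_tcat x y : coact TY (tcat x y) =
  \osum_(a, x0 <- coact TY x) \osum_(b, y0 <- coact TY y) ((a * b) \ox tcat x0 y0).
Proof.
move: x; apply: talg_ext => [||s]; [lin..|].
elim: s => [|v s IH].
  rewrite tcat1x coact_one; nrmR idtac.
  by rewrite -[LHS]tlift_id; peel; rewrite tcat1x mul1r.
rewrite word_cons -tcatA !coact_cons IH; nrmL idtac; apply: esym; nrmL idtac.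
by do 3 peel; rewrite tcatA mulrA.
Qed.

(** Together with [deconc_coact] this makes deconcatenation a morphism, which is what allows
    braidings to be moved through it in [bcop_act], [bcop_coact] and [bcopA]. *)
Lemma deconc_act h x : deconc (act TY h x) =
  \osum_(h1, h2 <- D h) \osum_(x1, x2 <- deconc x) (act TY h1 x1 \ox act TY h2 x2).
Proof.
move: x; apply: talg_ext => [||s]; [lin..|].
elim: s h => [|v s IH] h.
  rewrite act_one (linZ _ _ (@lin_deconc _ _)) deconc1; apply: esym; nrmL idtac.
  rewrite -(counitlF hopf (F := fun h => eps h *: (one \ox one))).
    by peel; rewrite !act_one pureZl pureZr.
  by apply: lin_scalel; apply: lin_counit.
rewrite word_cons act_cons; etransitivity; [nrm idtac|cbv beta].
etransitivity; [apply: eq_tlift => h1 h2; rewrite deconc_cons IH; reflexivity|].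
rewrite tlift_add; apply: esym.
etransitivity; [apply: eq_tlift => h1 h2; rewrite deconc_consF ?act_one ?pureZl;
    [reflexivity|lin]|].
rewrite tlift_add; congr (_ + _).
  rewrite (counitlF hopf (F := fun h => one \ox act TY h _)); last lin.
  by rewrite act_cons; nrm idtac.
etransitivity; [apply: eq_tlift => h1 h2; etransitivity; [apply: eq_tlift => x1 x2;
    rewrite act_cons; nrm idtac| pull (D h1); reflexivity]|].
by rw coassocF; peel; nrmR idtac.
Qed.

Lemma deconc_coact x : \osum_(a, x0 <- coact TY x) (a \ox deconc x0) =
  \osum_(x1, x2 <- deconc x) \osum_(a, y1 <- coact TY x1) \osum_(b, y2 <- coact TY x2)
    ((a * b) \ox (y1 \ox y2)).
Proof.
move: x; apply: talg_ext => [||s]; [lin..|].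
elim: s => [|v s IH].
  rewrite deconc1F ?coact_one; last lin.
  nrmL ltac:(rewrite ?deconc1); apply: esym; nrmL idtac; by rewrite mulr1.
rewrite word_cons coact_cons deconc_consF; last lin.
nrmL idtac.
etransitivity; [do 2 apply: eq_tlift => ? ?; rewrite deconc_cons (linD _ _ (lin_pure2 _
    (@lin_id _ _))); reflexivity|cbv beta].
etransitivity; [apply: eq_tlift => ? ?; rewrite tlift_add; reflexivity|].
rewrite tlift_add; congr (_ + _).
  rewrite coact_one coact_cons; apply: esym; nrmL idtac.
  by do 2 peel; rewrite mul1r.
(* [G a v0] re-attaches the letter v0 and its coaction component a, so that the induction hypothesis
   enters as an equation in H (x) (T(V) (x) T(V)). *)
pose G (a : H) (v0 : V) (t : H \ox (talg V \ox talg V)) := \osum_(b, p <- t) \osum_(x1, x2 <-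
    p) ((a * b) \ox (tcat [w v0] x1 \ox x2)).
have lG a v0 : lin (G a v0) by rewrite /G; lin.
transitivity (\osum_(a, v0 <- coact Y v) G a v0 (\osum_(a, x0 <- coact TY (word s)) (a \ox
    deconc x0))).
  peel; rewrite /G; apply: esym; nrmL idtac; peel; apply: esym; by nrm idtac.
rewrite IH; apply: esym.
etransitivity; [apply: eq_tlift => x1 x2; rewrite coact_cons; nrm idtac|cbv beta].
pull (coact Y v); apply: eq_tlift => a v0; rewrite /G; nrmR idtac.
by do 3 peel; rewrite mulrA.
Qed.

Lemma homog_act n h x : homog n (act TY h x) = act TY h (homog n x).
Proof.
move: x; apply: talg_ext => [||s]; [lin..|].
elim: s h n => [|v s IH] h [|n].
- by rewrite !homog_one act_one (linZ _ _ (@lin_homog _ _ _)) homog_one.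
- by rewrite !homog_one act_one (linZ _ _ (@lin_homog _ _ _)) homog_one scaler0 lin0.
- rewrite word_cons homog0_cons lin0 // act_cons (app_tlift _ _ (@lin_homog _ _ _)).
  by rewrite tliftE big1 // => p _; rewrite homog0_cons scaler0.
rewrite word_cons homogS_cons !act_cons (app_tlift _ _ (@lin_homog _ _ _)).
by peel; rewrite homogS_cons IH.
Qed.

Lemma coact_homog n x : coact TY (homog n x) = \osum_(a, x0 <- coact TY x) (a \ox homog n x0).
Proof.
move: x; apply: talg_ext => [||s]; [lin..|].
elim: s n => [|v s IH] [|n].
- by rewrite homog_one coact_one; nrmR idtac; rewrite homog_one.
- rewrite homog_one lin0 // coact_one; nrmR idtac.
  by rewrite homog_one (lin0 (lin_pure2 _ (@lin_id _ _))).
- rewrite word_cons homog0_cons lin0 // coact_cons; nrmR idtac.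
  rewrite tliftE big1 // => p _; rewrite tliftE big1 ?scaler0 // => q _.
  by rewrite homog0_cons (lin0 (lin_pure2 _ (@lin_id _ _))) scaler0.
rewrite word_cons homogS_cons !coact_cons IH; nrmL idtac; apply: esym; nrmL idtac.
by do 2 peel; rewrite homogS_cons.
Qed.

End TalgYD.

(** * Braid words acting on T(V) *)

Section SigmaAt.
Variables (K : fieldType) (V : lmodType K) (c : V \ox V -> V \ox V).
Hypothesis lc : lin c.
Local Notation "[ 'w' v ]" := (word [:: v]) (format "[ 'w'  v ]").
Implicit Types (x y : talg V) (s t : seq V) (v : V).

(** The body of [sigma_at] on words, named so that multilinearity follows by induction on the
    position through [sgS] and [sg0]. *)
Let sg p (w : seq V) : talg V :=
    if drop p w is v1 :: v2 :: w' then
      \osum_(u1, u2 <- c (v1 \ox v2)) word (take p w ++ [:: u1, u2 & w'])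
    else 0.

Let sgS p v s : sg p.+1 (v :: s) = tcat [w v] (sg p s).
Proof.
rewrite /sg /=; case: (drop p s) => [|v1 [|v2 t]]; rewrite ?(lin0 (@lin_tcatr _ _ _)) //.
rewrite (app_tlift _ _ (@lin_tcatr _ _ _)); peel.
by rewrite tcat_word.
Qed.

Let sg0 v1 v2 s : sg 0 (v1 :: v2 :: s) = \osum_(u1, u2 <- c (v1 \ox v2)) tcat [w u1] (tcat [w
    u2] (word s)).
Proof. by rewrite /sg /=; peel; rewrite !tcat_word. Qed.

Let sg_multi p : is_multilinear (sg p).
Proof.
move=> s t; change (lin (fun v => sg p (s ++ v :: t))).
elim: p s => [|p IH] [|u s] /=.
- case: t => [|v2 t]; first exact: lin_const0.
  move=> a v v'; rewrite !sg0; move: a v v'.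
  change (lin (fun v => \osum_(u1, u2 <- c (v \ox v2)) tcat [w u1] (tcat [w u2] (word t)))).
  by lin.
- case: s => [|u2 s] /= a v v'; rewrite !sg0; move: a v v'.
    change (lin (fun v => \osum_(u1, u2 <- c (u \ox v)) tcat [w u1] (tcat [w u2] (word t)))).
    by lin.
  change (lin (fun v => \osum_(u1, u2 <- c (u \ox u2)) tcat [w u1] (tcat [w u2] (word (s ++ v
      :: t))))).
  apply: lin_tliftr => u1 u3; apply: (lin_comp (@lin_tcatr _ _ _)).
  apply: (lin_comp (@lin_tcatr _ _ _)); exact: (@word_multilinear K V).
- move=> a v v'; rewrite !sgS; move: a v v'.
  change (lin (fun v => tcat [w v] (sg p t))); by lin.
move=> a v v'; rewrite !sgS; move: a v v'.
exact: (lin_comp (@lin_tcatr _ _ _) (IH s)).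
Qed.

Lemma lin_sigma_at p : lin (sigma_at c p).
Proof. exact: lin_wlift (@sg_multi p). Qed.
Local Hint Resolve lin_sigma_at : linbase.

Let sigma_at_word p s : sigma_at c p (word s) = sg p s.
Proof. exact: wlift_word (@sg_multi p). Qed.

Lemma sigma_at0 v1 v2 x : sigma_at c 0 (tcat [w v1] (tcat [w v2] x)) =
  \osum_(u1, u2 <- c (v1 \ox v2)) tcat [w u1] (tcat [w u2] x).
Proof.
move: x; apply: talg_ext => [||s]; [lin..|].
by rewrite !tcat_word sigma_at_word sg0.
Qed.

Lemma sigma_atS p v x : sigma_at c p.+1 (tcat [w v] x) = tcat [w v] (sigma_at c p x).
Proof.
move: x; apply: talg_ext => [||s]; [lin..|].
by rewrite !tcat_word !sigma_at_word /= sgS.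
Qed.

Lemma braid_word_cat l l' x : braid_word c (l ++ l') x = braid_word c l (braid_word c l' x).
Proof. by rewrite /braid_word foldr_cat. Qed.

Lemma lin_braid_word l : lin (braid_word c l).
Proof. by elim: l => [//|p l IH]; apply: (lin_comp (@lin_sigma_at p) IH). Qed.
Local Hint Resolve lin_braid_word : linbase.

Lemma braid_word_shift l s x :
  braid_word c (map (addn (size s)) l) (tcat (word s) x) = tcat (word s) (braid_word c l x).
Proof.
elim: s l x => [|v s IH] l x; first by rewrite (map_id_in (fun n _ => add0n n)) !tcat1x.
rewrite word_cons -!tcatA -IH /=.
elim: l => [//|p l /= ->].
by rewrite sigma_atS.
Qed.

Lemma homog_sigma_at n p x : homog n (sigma_at c p x) = sigma_at c p (homog n x).
Proof.
move: x; apply: talg_ext => [||s]; [lin..|].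
elim: p n s => [|p IH] n s.
  case: s => [|v1 [|v2 s]].
  - rewrite homog_word sigma_at_word /sg /= (lin0 (@lin_homog _ _ _)).
    by case: ifP => _; rewrite ?sigma_at_word // lin0 //; lin.
  - rewrite homog_word sigma_at_word /sg /= (lin0 (@lin_homog _ _ _)).
    by case: ifP => _; rewrite ?sigma_at_word // lin0 //; lin.
  rewrite (word_cons v1) (word_cons v2) sigma_at0 (app_tlift _ _ (@lin_homog _ _ _)).
  case: n => [|[|n]].
  - rewrite homog0_cons (lin0 (@lin_sigma_at 0)) tliftE big1 // => q _.
    by rewrite homog0_cons scaler0.
  - rewrite homogS_cons homog0_cons !lin0; [|lin..].
    by rewrite tliftE big1 // => q _; rewrite homogS_cons homog0_cons lin0 ?scaler0 //; lin.
  by rewrite !homogS_cons sigma_at0; peel; rewrite !homogS_cons.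
case: s => [|v s].
  rewrite homog_word sigma_at_word /sg /= (lin0 (@lin_homog _ _ _)).
  by case: ifP => _; rewrite ?sigma_at_word // lin0 //; lin.
rewrite word_cons sigma_atS; case: n => [|n].
  by rewrite !homog0_cons lin0 //; lin.
by rewrite !homogS_cons sigma_atS IH.
Qed.

Lemma homog_braid_word n l x : homog n (braid_word c l x) = braid_word c l (homog n x).
Proof. by elim: l => [//|p l IH] /=; rewrite homog_sigma_at IH. Qed.

(** Writing [homog n x] instead of assuming x of degree n keeps the statement linear in x, so that
    it reduces to words. *)
Lemma sigma_at_tcat n p x y : (p.+1 < n)%N ->
  sigma_at c p (tcat (homog n x) y) = tcat (sigma_at c p (homog n x)) y.
Proof.
move=> ltpn; move: x; apply: talg_ext => [||s]; [lin..|].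
rewrite homog_word; case: eqP => [sn|_]; last first.
  by rewrite !(lin0 (@lin_tcatl _ _ _)) (lin0 (@lin_sigma_at p)) (lin0 (@lin_tcatl _ _ _)).
rewrite -sn in ltpn => {sn n}.
elim: p s ltpn => [|p IH] [|v s] //=.
  case: s => [//|v2 s] _; rewrite (word_cons v) (word_cons v2) -!tcatA !sigma_at0.
  by rewrite (app_tlift _ _ (@lin_tcatl _ _ _)); peel; rewrite !tcatA.
rewrite ltnS => lt; rewrite word_cons -tcatA !sigma_atS IH //.
by rewrite tcatA.
Qed.

Lemma braid_word_tcat n l x y : all (fun p => p.+1 < n)%N l ->
  braid_word c l (tcat (homog n x) y) = tcat (braid_word c l (homog n x)) y.
Proof.
elim: l => [//|p l IH] /= /andP[lt /IH->].
by rewrite -homog_braid_word sigma_at_tcat.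
Qed.

End SigmaAt.

Lemma wlift_lin (K : fieldType) (V W : lmodType K) (L : talg V -> W) x :
  lin L -> wlift (fun s => L (word s)) x = L x.
Proof.
move=> lL; rewrite wliftE [in RHS](talg_span x) lin_sum //.
by apply: eq_bigr => p _; rewrite linZ.
Qed.

(** * The braiding beta as the natural braiding of T(V) *)

Section Beta.
Variables (K : fieldType) (H : algType K) (hopf : hopf_algebra H).
Variables (V : lmodType K) (Y : hstruct H V).
Hypothesis Y_yd : yetter_drinfeld hopf Y.
Local Notation TY := (yd_talg hopf Y).
Local Notation "[ 'w' v ]" := (word [:: v]) (format "[ 'w'  v ]").
Local Notation c := (yd_braiding Y).

Let lY : hlin Y := yd_hlin Y_yd.
Let Yat : forall v, yd_at hopf Y v. Proof. by case/yd_atP: Y_yd. Qed.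
Let lT1 h : lin (act TY h). Proof. by case: (hlin_talg Y_yd). Qed.
Let lT2 v : lin ((act TY)^~ v). Proof. by case: (hlin_talg Y_yd). Qed.
Let lTC : lin (coact TY). Proof. by case: (hlin_talg Y_yd). Qed.
Let TYat : forall x, yd_at hopf TY x. Proof. by case/yd_atP: (yd_talgP Y_yd). Qed.
Let lc : lin c := lin_yd_braiding Y_yd.
Let lb l : lin (braid_word c l) := lin_braid_word lc l.

(** The letter v passes through b: each crossing uses one factor of the iterated coaction of v, and
    coassociativity collects the factors into the diagonal action on b. *)
Lemma braid_row b v : braid_word c (rev (iota 0 (size b))) (tcat [w v] (word b)) =
  \osum_(g, v0 <- coact Y v) tcat (act TY g (word b)) [w v0].
Proof.
elim: b v => [|b0 b IH] v.
  transitivity [w v]; first by rewrite tcatx1.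
  rewrite -[X in word [:: X]](at_counit (Yat v)); nrmL idtac; peel.
  by rewrite (act_one Y_yd) (linZ _ _ (@lin_tcatl _ _ _)) tcat1x (linZ _ _ (lin_word1 (@lin_id
      _ _))).
rewrite (_ : rev _ = rev (iota (1 + 0) (size b)) ++ [:: 0%N]);
    last by rewrite /= rev_cons cats1.
rewrite braid_word_cat -[braid_word c [:: _] _]/(sigma_at c 0 _) (word_cons b0) sigma_at0 //.
rewrite (yd_braidingE Y_yd) iotaDl -map_rev.
rewrite (app_tlift _ _ (lin_braid_word lc _)).
nrmL idtac.
etransitivity; [apply: eq_tlift => g v0|].
  by rewrite (braid_word_shift lc _ [:: act Y g b0]) IH; nrm idtac.
rwV (coactAF (hopf := hopf) (F := fun g h v0 => tcat [w act Y g b0] (tcat (act TY h (word b))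
    [w v0])) lY).
peel; rewrite (act_cons Y_yd); nrmR idtac; peel.
by rewrite tcatA.
Qed.

(** [chi_word] consists of one row per letter of a, and the row of the last letter acts first; hence
    the induction on a from the right. *)
Lemma braid_chi a j y :
  braid_word c (chi_word (size a) j) (tcat (word a) (homog j y)) =
  \osum_(g, x0 <- coact TY (word a)) tcat (act TY g (homog j y)) x0.
Proof.
elim/last_ind: a y => [|a v IH] y.
  rewrite tcat1x (coact_one Y_yd); nrmR idtac.
  by rewrite tcatx1 (at1 (TYat _)).
have row : braid_word c (rev (iota 0 j)) (tcat [w v] (homog j y)) =
    \osum_(g, v0 <- coact Y v) tcat (act TY g (homog j y)) [w v0].
  move: y; apply: talg_ext => [||b]; [lin..|].
  rewrite homog_word; case: eqP => [<-|_]; first exact: braid_row.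
  rewrite (lin0 (@lin_tcatr _ _ _)) (lin0 (lin_braid_word lc _)).
  by rewrite tliftE big1 // => p _; rewrite lin0 // (lin0 (@lin_tcatl _ _ _)) scaler0.
rewrite size_rcons /chi_word -addn1 iotaD map_cat flatten_cat [flatten (map _ (iota _ 1))]/=
    cats0 add0n.
rewrite braid_word_cat -/(chi_word _ _).
rewrite (word_rcons a) -tcatA -[X in iota X j]addn0 iotaDl -map_rev (braid_word_shift lc) row.
rewrite (app_tlift _ _ (@lin_tcatr _ _ _)) (app_tlift _ _ (lin_braid_word lc _)).
rewrite (coact_tcat Y_yd) (coact_word1 Y_yd); nrmR idtac; apply: esym.
pull (coact Y v); apply: eq_tlift => g v0; rewrite tcatA.
(* The remaining braid word only touches the first [size a + j] letters; exhibiting that degree lets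
   [braid_word_tcat] leave the letter v0 aside. *)
have E : tcat (word a) (act TY g (homog j y)) =
    homog (size a + j) (tcat (word a) (act TY g (homog j y))).
  rewrite -(homog_act Y_yd); move: (act TY g y) => z.
  elim: (a) => [|u s IHs]; first by rewrite tcat1x homog_homog eqxx.
  by rewrite word_cons -tcatA homogS_cons -IHs.
rewrite E braid_word_tcat //; last first.
  apply/allP => p /flattenP[l /mapP[i]]; rewrite mem_iota add0n => lt ->.
  by rewrite mem_rev mem_iota; lia.
rewrite -E -(homog_act Y_yd) IH; apply: esym; nrmL idtac; peel.
by rewrite !(homog_act Y_yd) (atM (TYat _)) tcatA.
Qed.

Lemma split_at_tcat j (x y : talg V) : split_at j (tcat (homog j x) y) = homog j x \ox y.
Proof.
move: x; apply: talg_ext => [||s]; [lin..|].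
move: y; apply: talg_ext => [||t]; [lin..|].
rewrite homog_word; case: eqP => [<-|_]; last first.
  by rewrite (lin0 (@lin_tcatl _ _ _)) (lin0 (@lin_split_at _ _ _)) (lin0 (lin_pure1 _ (@lin_id
      _ _))).
by rewrite tcat_word split_at_word take_size_cat ?drop_size_cat.
Qed.

(** On words this is [braid_chi]; the cut made by [split_at] falls in the right place because the
    action preserves the length of the second word. *)
Lemma beta_yd t : beta c t = yd_braiding TY t.
Proof.
rewrite /beta /yd_braiding; apply: eq_tlift => x y.
transitivity (wlift (fun a => wlift (fun b => \osum_(g, x0 <- coact TY (word a)) (act TY g
    (word b) \ox x0)) y) x).
  apply: eq_wlift => a; apply: eq_wlift => b.
  have E : homog (size b) (word b) = word b :> talg V by rewrite homog_word eqxx.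
  rewrite -tcat_word -E.
  rewrite braid_chi (app_tlift _ _ (@lin_split_at _ _ _)); peel.
  by rewrite -(homog_act Y_yd) split_at_tcat.
rewrite (wlift_lin (L := fun a => wlift (fun b => \osum_(g, x0 <- coact TY a) (act TY g (word
    b) \ox x0)) y)).
  by rewrite (wlift_lin (L := fun b => \osum_(g, x0 <- coact TY x) (act TY g b \ox x0))) //;
      lin.
by apply: lin_wliftr => b; lin.
Qed.

End Beta.

(** * The product on the tensor algebra *)

Section BraidedCoproduct.
Variables (K : fieldType) (H : algType K) (hopf : hopf_algebra H).
Local Notation D := (comul hopf).
Variables (V : lmodType K) (Y : hstruct H V).
Hypothesis Y_yd : yetter_drinfeld hopf Y.
Local Notation TY := (yd_talg hopf Y).
Local Notation T := (talg V).
Local Notation one := (word [::] : talg V).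
Local Notation d := (@deconc K V).
Local Notation rho := (coact TY).
Implicit Types (x y z : T) (W X : lmodType K).
Local Opaque yd_talg.

Let lT : hlin TY := hlin_talg Y_yd.
Let TYat : forall x, yd_at hopf TY x. Proof. by case/yd_atP: (yd_talgP Y_yd). Qed.

Lemma deconc_coactF W (F : H -> T -> T -> W) x :
  (forall b c, lin (fun a => F a b c)) -> (forall a c, lin (fun b => F a b c)) ->
  (forall a b, lin (fun c => F a b c)) ->
  \osum_(a, x0 <- rho x) \osum_(x1, x2 <- d x0) F a x1 x2 =
  \osum_(x1, x2 <- d x) \osum_(a, y1 <- rho x1) \osum_(b, y2 <- rho x2) F (a * b) y1 y2.
Proof.
move=> F1 F2 F3.
pose G (t : H \ox (T \ox T)) := \osum_(a, p <- t) \osum_(x1, x2 <- p) F a x1 x2.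
transitivity (G (\osum_(a, x0 <- rho x) (a \ox d x0))).
  by rewrite /G; nrmR idtac.
by rewrite (deconc_coact Y_yd) /G; nrm idtac.
Qed.

Lemma deconc_actF W (F : T -> T -> W) h x : is_bilinear F ->
  \osum_(x1, x2 <- d (act TY h x)) F x1 x2 =
  \osum_(h1, h2 <- D h) \osum_(x1, x2 <- d x) F (act TY h1 x1) (act TY h2 x2).
Proof.
case=> F1 F2; have {}F1 : forall y, lin (F^~ y) := F1; have {}F2 : forall y, lin (F y) := F2.
by rewrite (deconc_act Y_yd); nrm idtac.
Qed.

(* The value of [F] on the coproduct of [x (x) y] in the braided tensor square
   of T(V). *)
Definition bcop W (F : T -> T -> T -> T -> W) x y : W :=
  \osum_(x1, x2 <- d x) \osum_(y1, y2 <- d y) \osum_(g, x0 <- rho x2)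
    F x1 (act TY g y1) x0 y2.

Lemma eq_bcop W (F G : T -> T -> T -> T -> W) x y :
  (forall a b c e, F a b c e = G a b c e) -> bcop F x y = bcop G x y.
Proof. by move=> FG; do 3 peel; rewrite FG. Qed.

Lemma app_bcop W X (f : W -> X) (F : T -> T -> T -> T -> W) x y :
  lin f -> f (bcop F x y) = bcop (fun a b c e => f (F a b c e)) x y.
Proof. by move=> lf; rewrite /bcop; nrm idtac. Qed.

Lemma bcop_zero W x y : bcop (fun _ _ _ _ => 0 : W) x y = 0.
Proof. exact: (esym (app_bcop (fun _ _ _ _ => 0 : W) x y (@lin_const0 _ W W))). Qed.

Section Linear.
Variables (W : lmodType K) (F : T -> T -> T -> T -> W).
Hypotheses (F1 : forall b c e, lin (fun a => F a b c e))
  (F2 : forall a c e, lin (fun b => F a b c e))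
  (F3 : forall a b e, lin (fun c => F a b c e)) (F4 : forall a b c, lin (fun e => F a b c e)).

Lemma lin_bcopl y : lin (fun x => bcop F x y).
Proof. by rewrite /bcop; lin. Qed.

Lemma lin_bcopr x : lin (fun y => bcop F x y).
Proof. by rewrite /bcop; lin. Qed.

(** Beyond reordering and (co)associativity, the only step is Yetter-Drinfeld compatibility at [x2],
    the part of x that crosses [y1]. *)
Lemma bcop_act h x y :
  \osum_(h1, h2 <- D h) bcop F (act TY h1 x) (act TY h2 y) =
  bcop (fun a b c e => \osum_(k, l <- D h) \osum_(k1, k2 <- D k) \osum_(l1, l2 <- D l)
    F (act TY k1 a) (act TY k2 b) (act TY l1 c) (act TY l2 e)) x y.
Proof.
rewrite /bcop.
etransitivity; [apply: eq_tlift => h1 h2|cbv beta].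
  rewrite deconc_actF; last lin.
  in2 (rewrite deconc_actF; last lin).
  reflexivity.
in1 (pull (d x); reflexivity).
pull (d x); apply: eq_tlift => x1 x2.
in2 (etransitivity; [apply: eq_tlift => ? ?; pull (d y); reflexivity|pull (d y); reflexivity]).
in1 (pull (d y); reflexivity).
pull (d y); apply: eq_tlift => y1 y2.
rw coassocF.
in1 (rwV coassocF).
etransitivity; [apply: eq_tlift => p h'; apply: eq_tlift => qr s|cbv beta].
  in2 (rewrite -(atM (TYat _))).
  rwV (compatF (hopf := hopf) (F := fun g z => F (act TY p x1) (act TY g y1) z (act TY s y2))
      lT).
  by reflexivity.
pullR (D h).
in1 (rw coassocF).
rwV coassocF; apply: eq_tlift => k l.
apply: esym; pull (rho x2); apply: esym; pull (rho x2).
apply: eq_tlift => g z; apply: eq_tlift => k1 k2; apply: eq_tlift => l1 l2.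
by rewrite (atM (TYat _)).
Qed.

End Linear.

(** [G] carries the H-component in its first argument. The step with content is compatibility at
    [y1], acted on by the coaction component of [x2]. *)
Lemma bcop_coact W (G : H -> T -> T -> T -> T -> W) x y :
  (forall b c e f, lin (fun a => G a b c e f)) ->
  (forall a c e f, lin (fun b => G a b c e f)) ->
  (forall a b e f, lin (fun c => G a b c e f)) ->
  (forall a b c f, lin (fun e => G a b c e f)) ->
  (forall a b c e, lin (fun f => G a b c e f)) ->
  \osum_(a, x0 <- rho x) \osum_(b, y0 <- rho y) bcop (G (a * b)) x0 y0 =
  bcop (fun p q r s => \osum_(a, p0 <- rho p) \osum_(b, q0 <- rho q)
    \osum_(c, r0 <- rho r) \osum_(e, s0 <- rho s) G (a * b * (c * e)) p0 q0 r0 s0) x y.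
Proof.
move=> G1 G2 G3 G4 G5; rewrite /bcop.
etransitivity; [apply: eq_tlift => a x0; pull (d x0); reflexivity|].
rw deconc_coactF; apply: eq_tlift => x1 x2.
in2 (rw deconc_coactF).
etransitivity; [apply: eq_tlift => a p; pull (d y); reflexivity|].
pull (d y); apply: esym; pull (d y); apply: esym; apply: eq_tlift => y1 y2.
apply: esym; pull (rho x1); apply: esym; apply: eq_tlift => a p.
etransitivity; [apply: eq_tlift => b u2; pull (rho u2); reflexivity|].
rwV (coactAF (hopf := hopf) (F := fun b g z => \osum_(e, q <- rho y1) \osum_(f, s <- rho y2)
  G (a * b * (e * f)) p (act TY g q) z s) lT).
apply: esym; etransitivity; [apply: eq_tlift => g z; pull (rho z); reflexivity|].
rwV (coactAF (hopf := hopf) (F := fun g c z => \osum_(b, q <- rho (act TY g y1)) \osum_(e, s <-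
    rho y2)
  G (a * b * (c * e)) p q z s) lT).
apply: eq_tlift => g z; apply: esym.
etransitivity; [do 2 apply: eq_tlift => ? ?; apply: eq_tlift => f s;
    rewrite -mulrA [X in a * X]mulrA; reflexivity|].
rw (compatF (F := fun h q => \osum_(f, s <- rho y2) G (a * (h * f)) p q z s) lT).
by do 3 peel; rewrite !mulrA.
Qed.

(** Coassociativity of the braided coproduct: deconcatenation is coassociative, and being a morphism
    it can be moved through the crossing, by [deconc_actF] for the part of y and by [deconc_coactF]
    for the part of x. *)
Lemma bcopA W (F : T -> T -> T -> T -> T -> T -> W) x y :
  (forall b c e f g, lin (fun a => F a b c e f g)) ->
  (forall a c e f g, lin (fun b => F a b c e f g)) ->
  (forall a b e f g, lin (fun c => F a b c e f g)) ->
  (forall a b c f g, lin (fun e => F a b c e f g)) ->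
  (forall a b c e g, lin (fun f => F a b c e f g)) ->
  (forall a b c e f, lin (fun g => F a b c e f g)) ->
  bcop (fun a b c e => bcop (fun a1 b1 a2 b2 => F a1 b1 a2 b2 c e) a b) x y =
  bcop (fun a b c e => bcop (fun c1 e1 c2 e2 => F a b c1 e1 c2 e2) c e) x y.
Proof.
move=> F1 F2 F3 F4 F5 F6; rewrite /bcop.
etransitivity; [apply: eq_tlift => x1 x2; pull (d x1); reflexivity|].
rw deconcA; apply: eq_tlift => x1 x'.
etransitivity; [apply: eq_tlift => x2 x3; apply: eq_tlift => y' y3; apply: eq_tlift => g z|].
  rewrite deconc_actF; last lin.
  by pull (d y').
etransitivity; [apply: eq_tlift => x2 x3; apply: eq_tlift => y' y3; pull (d y'); reflexivity|].
in1 (rw deconcA).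
pull (d y).
apply: esym; pull (d y); apply: eq_tlift => y1 y'; apply: esym; pull (d y').
apply: esym; etransitivity; [apply: eq_tlift => g z; pull (d z); reflexivity|].
rw deconc_coactF; pull (d y').
apply: eq_tlift => y2 y3; apply: eq_tlift => x2 x3.
etransitivity; [apply: eq_tlift => g1 z|].
  rwV (coactAF (hopf := hopf) (F := fun g h u => F x1 (act TY (g1 * g) y1) z (act TY h y2) u
      y3) lT).
  reflexivity.
pull (rho x3); apply: eq_tlift => g z.
apply: esym; pull (D g); apply: esym; pull (D g).
apply: eq_tlift => g1 g2; apply: eq_tlift => k u.
by rewrite (atM (TYat _)).
Qed.

Lemma bcop_counitl W (F : T -> T -> T -> T -> W) x y :
  (forall b c e, lin (fun a => F a b c e)) ->
  (forall a c e, lin (fun b => F a b c e)) ->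
  (forall a b e, lin (fun c => F a b c e)) -> (forall a b c, lin (fun e => F a b c e)) ->
  bcop (fun a b c e => F (homog 0 a) (homog 0 b) c e) x y = F one one x y.
Proof.
move=> F1 F2 F3 F4; rewrite /bcop.
rewrite (deconc_counitlF (F := fun x1 x2 => \osum_(y1, y2 <- d y) \osum_(g, x0 <- rho x2)
  F x1 (homog 0 (act TY g y1)) x0 y2)); last lin.
etransitivity; [do 2 apply: eq_tlift => ? ?; rewrite (homog_act Y_yd); reflexivity|].
rewrite (deconc_counitlF (F := fun y1 y2 => \osum_(g, x0 <- rho x)
  F one (act TY g y1) x0 y2)); last lin.
etransitivity; [|apply: (coact_counitF (hopf := hopf) (F := fun x => F one one x y) lT (TYat
    x)); lin].
by peel; rewrite (act_one Y_yd) (linZ _ _ (F2 _ _ _)).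
Qed.

Lemma bcop_counitr W (F : T -> T -> T -> T -> W) x y :
  (forall b c e, lin (fun a => F a b c e)) ->
  (forall a c e, lin (fun b => F a b c e)) ->
  (forall a b e, lin (fun c => F a b c e)) -> (forall a b c, lin (fun e => F a b c e)) ->
  bcop (fun a b c e => F a b (homog 0 c) (homog 0 e)) x y = F x y one one.
Proof.
move=> F1 F2 F3 F4; rewrite /bcop.
etransitivity; [apply: eq_tlift => x1 x2; pull (rho x2); apply: eq_tlift => g z|].
  rewrite (deconc_counitrF (F := fun y1 y2 => F x1 (act TY g y1) (homog 0 z) y2)); last lin.
  reflexivity.
transitivity (\osum_(x1, x2 <- d x) \osum_(g, z <- rho (homog 0 x2)) F x1 (act TY g y) z one).
  by peel; rewrite (coact_homog Y_yd); nrmR idtac.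
rewrite (deconc_counitrF (F := fun x1 x2 => \osum_(g, z <- rho x2) F x1 (act TY g y) z one));
    last lin.
by rewrite (coact_one Y_yd); nrmL idtac; rewrite (at1 (TYat _)).
Qed.

End BraidedCoproduct.

(** * The grading of T(V) *)

Section Grading.
Variables (K : fieldType) (V : lmodType K).
Implicit Types (U W : lmodType K) (x y : talg V).
Local Notation one := (word [::] : talg V).

(** All larger bounds are allowed so that [homog_injl] can cut two tensors at a common one. *)
Lemma homog_bound U (t : talg V \ox U) :
  exists N, forall N', (N <= N')%N -> t = \sum_(n < N') tmap (homog n) id t.
Proof.
have lh n : lin (tmap (homog n) id : talg V \ox U -> talg V \ox U) by rewrite /tmap; lin.
have word_case s u : exists N, forall N', (N <= N')%N ->
    word s \ox u = \sum_(n < N') tmap (homog n) id (word s \ox u : talg V \ox U).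
  exists (size s).+1 => N' lt; rewrite (bigD1 (Ordinal lt)) //= big1 => [|n ne].
    by rewrite addr0 /tmap tlift_pure ?homog_word ?eqxx //; lin.
  rewrite /tmap tlift_pure; last lin.
  rewrite homog_word eq_sym; case: eqP => [e|_]; last exact: (lin0 (lin_pure1 _ (@lin_id _ _))).
  by case/eqP: ne; apply/val_inj.
have comb a (u v : talg V \ox U) :
    (exists N, forall N', (N <= N')%N -> u = \sum_(n < N') tmap (homog n) id u) ->
    (exists N, forall N', (N <= N')%N -> v = \sum_(n < N') tmap (homog n) id v) ->
    (exists N, forall N', (N <= N')%N -> a *: u + v = \sum_(n < N') tmap (homog n) id (a *: u +
        v)).
  move=> [N1 h1] [N2 h2]; exists (maxn N1 N2) => N'; rewrite geq_max => /andP[/h1 e1 /h2 e2].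
  rewrite {1}e1 {1}e2 scaler_sumr -big_split; apply: eq_bigr => n _; exact/esym/lh.
have zero : exists N, forall N', (N <= N')%N -> 0 = \sum_(n < N') tmap (homog n) id (0 : talg V
    \ox U).
  by exists 0%N => N' _; rewrite big1 // => n _; rewrite lin0.
rewrite (tens_span t); elim: (repr t) => [|[a [x u]] r IH]; first by rewrite big_nil.
rewrite big_cons /=; apply: (comb) => //.
rewrite [x]talg_span; elim: (repr x) => [|[b s] r' IH'].
  by rewrite big_nil (lin0 (lin_pure1 u (@lin_id _ _))).
by rewrite big_cons (lin_pure1 u (@lin_id _ _)); apply: (comb).
Qed.

Lemma homog_injl U (t t' : talg V \ox U) :
  (forall n, tmap (homog n) id t = tmap (homog n) id t') -> t = t'.
Proof.
move=> e; have [N h] := homog_bound t; have [N' h'] := homog_bound t'.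
rewrite (h _ (leq_maxl N N')) (h' _ (leq_maxr N N')).
by apply: eq_bigr => n _.
Qed.

Let sw U U' (t : U \ox U') : U' \ox U := \osum_(u, v <- t) (v \ox u).

Lemma homog_injr U (t t' : U \ox talg V) :
  (forall n, tmap id (homog n) t = tmap id (homog n) t') -> t = t'.
Proof.
have lsw U1 U2 : lin (@sw U1 U2) by rewrite /sw; lin.
have swK (x : U \ox talg V) : sw (sw x) = x.
  by rewrite /sw; etransitivity; [nrm idtac|rewrite tlift_id].
move=> e; rewrite -[t]swK -[t']swK; congr sw; apply: homog_injl => n.
have := congr1 (@sw _ _) (e n).
have E (x : U \ox talg V) : sw (tmap id (homog n) x) = tmap (homog n) id (sw x).
  by rewrite /sw /tmap; etransitivity; [nrm idtac|apply: esym; nrm idtac].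
by rewrite !E.
Qed.

Lemma homog_inj x y : (forall n, homog n x = homog n y) -> x = y.
Proof.
(* Concatenation recovers z from z (x) 1, which makes this an instance of [homog_injl]. *)
move=> e; pose f (t : talg V \ox talg V) : talg V := \osum_(u, v <- t) tcat u v.
have fE z : f (z \ox one) = z by rewrite /f tlift_pure ?tcatx1 //; lin.
rewrite -(fE x) -(fE y); congr f; apply: homog_injl => n.
by rewrite /tmap !tlift_pure ?e //; lin.
Qed.

Lemma homog_injlr (t t' : talg V \ox talg V) :
  (forall m n, tmap (homog m) (homog n) t = tmap (homog m) (homog n) t') -> t = t'.
Proof.
move=> e; apply: homog_injr => n; apply: homog_injl => m.
have E (x : talg V \ox talg V) : tmap (homog m) id (tmap id (homog n) x) = tmap (homog m)
    (homog n) x.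
  by rewrite /tmap; nrm idtac.
by rewrite !E.
Qed.

Lemma deconc_wordF W (F : talg V -> talg V -> W) s : is_bilinear F ->
  \osum_(x1, x2 <- deconc (word s)) F x1 x2 =
  \sum_(p < (size s).+1) F (word (take p s)) (word (drop p s)).
Proof.
move=> bF; rewrite deconc_word (lin_sum (f := tlift _)); last exact: tlift_linear.
by rewrite big_mkord; apply: eq_bigr => p _; rewrite tlift_pure.
Qed.

(** On a word s, the cut after p letters contributes to bidegree (k, n - k) exactly when p = k and s
    has length n. *)
Lemma deconc_homogF W (F : talg V -> talg V -> W) n x : is_bilinear F ->
  \osum_(x1, x2 <- deconc (homog n x)) F x1 x2 =
  \sum_(k < n.+1) \osum_(x1, x2 <- deconc x) F (homog k x1) (homog (n - k) x2).
Proof.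
case=> F1 F2; have {}F1 : forall y, lin (F^~ y) := F1; have {}F2 : forall y, lin (F y) := F2.
move: x; apply: talg_ext => [||s]; [lin|by apply: lin_bigsum => k; lin|].
have E p : (p <= size s)%N -> forall k, F (homog k (word (take p s))) (homog (n - k) (word
    (drop p s))) =
    if (p == k) && (size s - p == n - k)%N then F (word (take p s)) (word (drop p s)) else 0.
  move=> le k; rewrite !homog_word size_takel // size_drop.
  by case: eqP => _; case: eqP => _; rewrite ?(lin0 (F1 _)) ?(lin0 (F2 _)).
transitivity (\sum_(k < n.+1) \sum_(p < (size s).+1)
    if (p == k :> nat) && (size s - p == n - k)%N then F (word (take p s)) (word (drop p s))
        else 0); last first.
  apply: eq_bigr => k _; rewrite deconc_wordF; last lin.
  by apply: eq_bigr => p _; rewrite E // -ltnS.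
rewrite homog_word exchange_big /=; case: eqP => [<-|ne].
  rewrite deconc_wordF; last lin.
  apply: eq_bigr => p _; rewrite (bigD1 p) //= !eqxx big1 ?addr0 // => k ne.
  by rewrite eq_sym val_eqE (negPf ne).
rewrite (lin0 (@lin_deconc _ _)) (lin0 (f := tlift F)) ?big1 // => [p _|]; last by lin.
rewrite big1 // => k _.
by case: ifP => //; have := ltn_ord k; have := ltn_ord p; lia.
Qed.

(** The recursion for the identity map of T(V), against which the recursion [star_degS] of 1 * x and
    of x * 1 is compared. *)
Lemma homog_split n x :
  \osum_(x1, x2 <- deconc x) tcat (homog n x1) (homog 1 x2) = homog n.+1 x.
Proof.
move: x; apply: talg_ext => [||s]; [lin..|].
elim/last_ind: s => [|s v _].
  by rewrite deconc1F ?homog_one ?(lin0 (@lin_tcatr _ _ _)) //; lin.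
rewrite word_rcons deconc_rconsF; last lin.
rewrite homog_one (lin0 (@lin_tcatr _ _ _)) add0r homogS_rcons.
in1 (rewrite homogS_rcons).
rewrite (deconc_counitrF (F := fun x1 x2 => tcat (homog n x1) (tcat x2 (word [:: v]))));
    last lin.
by rewrite tcat1x.
Qed.

End Grading.

(** * Homogeneous components of the product, and its compatibility with deconcatenation *)

Section StarProduct.
Variables (K : fieldType) (H : algType K) (hopf : hopf_algebra H).
Local Notation D := (comul hopf).
Variables (V : lmodType K) (Y : hstruct H V).
Hypothesis Y_yd : yetter_drinfeld hopf Y.
Local Notation TY := (yd_talg hopf Y).
Local Notation T := (talg V).
Local Notation one := (word [::] : talg V).
Local Notation "[ 'w' v ]" := (word [:: v]) (format "[ 'w'  v ]").
Local Notation d := (@deconc K V).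
Local Notation rho := (coact TY).
Local Notation br := (yd_braiding Y).
Local Notation bcopY := (bcop hopf Y).
Implicit Types (x y z : T) (W X : lmodType K).
Local Opaque yd_talg.

Let lT : hlin TY := hlin_talg Y_yd.
Let lT1 h : lin (act TY h). Proof. by case: lT. Qed.
Let lTC : lin rho. Proof. by case: lT. Qed.

Variable M : T \ox T -> V.
Hypothesis lM : lin M.

(* [Mconv n], in curried form and with the counit as term of index 0; see
   [Mconv_star_deg] and [homog_star]. *)
Fixpoint star_deg n x y : T :=
  if n is n'.+1 then bcopY (fun a b c e => tcat (star_deg n' a b) [w M (c \ox e)]) x y
  else tcat (homog 0 x) (homog 0 y).

Lemma lin_star_deg n : (forall y, lin (fun x => star_deg n x y)) /\ (forall x, lin (fun y =>
    star_deg n x y)).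
Proof.
elim: n => [|n [IH1 IH2]]; split=> z /=; try lin.
  by apply: lin_bcopl => // *; lin.
by apply: lin_bcopr => // *; lin.
Qed.
Lemma lin_star_degl n y : lin (fun x => star_deg n x y). Proof. by case: (lin_star_deg n). Qed.
Lemma lin_star_degr n x : lin (fun y => star_deg n x y). Proof. by case: (lin_star_deg n). Qed.
Local Hint Resolve lin_star_degl lin_star_degr : linbase.

Arguments star_deg : simpl never.

Lemma star_deg0 x y : star_deg 0 x y = tcat (homog 0 x) (homog 0 y).
Proof. by []. Qed.

Lemma star_degS n x y : star_deg n.+1 x y = bcopY (fun a b c e => tcat (star_deg n a b) [w M (c
    \ox e)]) x y.
Proof. by []. Qed.

Lemma lin_coprod_beta : lin (coprod_beta br).
Proof.
have lb : lin (beta br).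
  by move=> a u v; rewrite !(beta_yd Y_yd); apply: (lin_yd_braiding (yd_talgP Y_yd)).
by rewrite /coprod_beta; lin.
Qed.

(** Thanks to [beta_yd], the coproduct in the definition of a quantum multi-brace algebra is
    replaced by [bcop] from here on. *)
Lemma coprod_betaE W (F : T \ox T -> T \ox T -> W) x y : is_bilinear F ->
  \osum_(t1, t2 <- coprod_beta br (x \ox y)) F t1 t2 =
  bcopY (fun a b c e => F (a \ox b) (c \ox e)) x y.
Proof.
case=> F1 F2; have {}F1 : forall t, lin (F^~ t) := F1; have {}F2 : forall t, lin (F t) := F2.
have lb : lin (beta br).
  by move=> a u v; rewrite !(beta_yd Y_yd); apply: (lin_yd_braiding (yd_talgP Y_yd)).
have bE u v : beta br (u \ox v) = \osum_(a, u0 <- rho u) (act TY a v \ox u0).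
  by rewrite (beta_yd Y_yd) (yd_braidingE (yd_talgP Y_yd)).
rewrite /coprod_beta /bcopY.
by nrm ltac:(rewrite ?bE).
Qed.

Lemma lin_cop_iter n : lin (cop_iter (coprod_beta br) n).
Proof.
elim: n => [//|n IH].
have lcb := lin_coprod_beta.
change (lin (fun t => tmap (cop_iter (coprod_beta br) n) id (coprod_beta br t))).
by rewrite /tmap; lin.
Qed.

Lemma lin_tpow_map n : lin (@tpow_map K (T \ox T)%type V M n).
Proof.
elim: n => [|n IH]; first exact: lin_word1.
change (lin (fun t : (tpow (T \ox T)%type n \ox (T \ox T))%type => \osum_(a, w <- t) tcat
    (tpow_map M a) (word [:: M w]))).
by lin.
Qed.

Lemma Mconv_star_deg n x y : Mconv br M n.+1 (x \ox y) = star_deg n.+1 x y.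
Proof.
rewrite /Mconv -[n.+1.-1]/n; have lcb := lin_coprod_beta.
elim: n x y => [|n IH] x y.
  (* [star_deg] starts one index lower than [Mconv]: its extra factor of index 0 is a counit and is
     absorbed by the coproduct. *)
  transitivity (bcopY (fun a b c e => tcat (tcat (homog 0 a) (homog 0 b)) [w M (c \ox e)]) x y)
      => //.
  rewrite (bcop_counitl Y_yd (F := fun a b c e => tcat (tcat a b) [w M (c \ox e)])); [|lin..].
  by rewrite !tcat1x.
have l1 := lin_cop_iter n; have l2 := @lin_tpow_map n.
rewrite star_degS; transitivity (bcopY (fun a b c e => tcat (tpow_map M (cop_iter (coprod_beta
    br) n (a \ox b))) [w M (c \ox e)]) x y); last first.
  by apply: eq_bcop => a b c' e; rewrite IH.
rewrite -(coprod_betaE (F := fun t1 t2 => tcat (tpow_map M (cop_iter (coprod_beta br) n t1)) [w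
    M t2])); last lin.
change (\osum_(a, w <- tmap (cop_iter (coprod_beta br) n) id (coprod_beta br (x \ox y))) tcat
    (tpow_map M a) (word [:: M w]) =
   \osum_(t1, t2 <- coprod_beta br (x \ox y)) tcat (tpow_map M (cop_iter (coprod_beta br) n
       t1)) [w M t2]).
by rewrite /tmap; nrm idtac.
Qed.

Lemma homog_star_deg k n x y : homog k (star_deg n x y) = if k == n then star_deg n x y else 0.
Proof.
elim: n k x y => [|n IH] k x y.
  rewrite star_deg0 !homog0E !(linZ _ _ (@lin_tcatl _ _ _)) !(linZ _ _ (@lin_tcatr _ _ _))
      !(linZ _ _ (@lin_homog _ _ _)).
  by rewrite tcat1x homog_one; case: ifP; rewrite ?scaler0.
rewrite !star_degS (app_bcop _ _ _ _ _ (@lin_homog _ _ _)).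
case: k => [|k].
  by rewrite -[RHS](bcop_zero hopf Y _ x y); apply: eq_bcop => *; rewrite homog0_rcons.
rewrite eqSS; case: eqP => [e|/eqP ne].
  by apply: eq_bcop => a b c' e'; rewrite homogS_rcons IH e eqxx.
rewrite -[RHS](bcop_zero hopf Y _ x y); apply: eq_bcop => *.
by rewrite homogS_rcons IH (negPf ne) (lin0 (@lin_tcatl _ _ _)).
Qed.

Hypothesis M00 : forall x y, M (homog 0 x \ox homog 0 y) = 0.

(** If fewer than n letters are distributed over n factors, some factor has bidegree (0, 0) and M
    kills it: either the first n - 1 factors already receive too few letters, or nothing is left for
    the last one. *)
Lemma star_deg_vanish n i j x y : (i + j < n)%N -> star_deg n (homog i x) (homog j y) = 0.
Proof.
elim: n i j x y => [//|n IH] i j x y lt.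
rewrite star_degS /bcopY deconc_homogF; last lin.
apply: big1 => k _; rewrite tliftE big1 // => p _; rewrite deconc_homogF; last lin.
rewrite big1 ?scaler0 // => l _; rewrite tliftE big1 // => q _.
rewrite (coact_homog Y_yd) tlift_tlift; last lin.
rewrite tliftE big1 ?scaler0 // => r _; rewrite tlift_pure; last lin.
rewrite -(homog_act Y_yd).
have [lt'|ge] := ltnP (k + l) n.
  by rewrite IH // (lin0 (@lin_tcatl _ _ _)) scaler0.
have -> : (i - k = 0)%N by have := ltn_ord k; have := ltn_ord l; lia.
have -> : (j - l = 0)%N by have := ltn_ord k; have := ltn_ord l; lia.
by rewrite M00 (lin0 (lin_word1 (@lin_id _ _))) (lin0 (@lin_tcatr _ _ _)) scaler0.
Qed.

Local Notation star := (star br M).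

(** The terms beyond the cut-off of [star] vanish, so one bound serves all words in the chosen
    representatives; [B] is the maximal word length in a representative. *)
Lemma star_sum_deg x y : exists N, forall N', (N <= N')%N -> star x y = \sum_(n < N') star_deg
    n x y.
Proof.
pose B x := \max_(p <- repr x) size p.2.
exists (B x + B y).+1 => N' leN.
have BP z p : p \in repr z -> (size p.2 <= B z)%N.
  by move=> pz; rewrite /B (big_rem p) //= leq_maxl.
rewrite /star wliftE.
transitivity (\sum_(p <- repr x) p.1 *: \sum_(q <- repr y) q.1 *: \sum_(n < N') star_deg n
    (word p.2) (word q.2)).
  rewrite !big_seq; apply: eq_bigr => p px; congr (_ *: _); rewrite wliftE.
  rewrite !big_seq; apply: eq_bigr => q qy; congr (_ *: _).
  have le := leq_add (BP _ _ px) (BP _ _ qy).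
  have -> : (N' = (size p.2 + size q.2).+1 + (N' - (size p.2 + size q.2).+1))%N by lia.
  rewrite big_split_ord /= [X in _ = _ + X]big1 ?addr0 => [|n _]; last first.
    have E s : word s = homog (size s) (word s) :> T by rewrite homog_word eqxx.
    rewrite (E p.2) (E q.2).
    by rewrite star_deg_vanish // leq_addr.
  rewrite big_ord_recl star_deg0 big_add1 /= big_mkord; congr (_ + _).
    by rewrite !homog0E (linZ _ _ (@lin_tcatl _ _ _)) (linZ _ _ (@lin_tcatr _ _ _)) tcat1x
        scalerA.
  by apply: eq_bigr => n _; rewrite Mconv_star_deg.
pose L x y := \sum_(n < N') star_deg n x y.
have L1 z : lin (L^~ z) by apply: lin_bigsum => n; apply: lin_star_degl.
have L2 z : lin (L z) by apply: lin_bigsum => n; apply: lin_star_degr.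
rewrite -/(L x y) -(wlift_lin x (L1 y)) wliftE; apply: eq_bigr => p _; congr (_ *: _).
by rewrite -(wlift_lin y (L2 (word p.2))) wliftE.
Qed.

Lemma homog_star n x y : homog n (star x y) = star_deg n x y.
Proof.
have [N /(_ (maxn N n.+1) (leq_maxl _ _)) ->] := star_sum_deg x y.
rewrite (lin_sum _ _ _ (@lin_homog _ _ _)) (bigD1 (Ordinal (leq_maxr N n.+1))) //=.
rewrite homog_star_deg eqxx big1 ?addr0 // => k ne; rewrite homog_star_deg ifN //.
by apply: contra ne => /eqP e; apply/eqP/val_inj.
Qed.

(** Linearity is inherited from the components, whose definition involves no cut-off. *)
Lemma lin_starl y : lin (star^~ y).
Proof.
move=> a u v; apply: homog_inj => n.
by rewrite (@lin_homog _ _ n) !homog_star (@lin_star_degl n y).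
Qed.

Lemma lin_starr x : lin (star x).
Proof.
move=> a u v; apply: homog_inj => n.
by rewrite (@lin_homog _ _ n) !homog_star (@lin_star_degr n x).
Qed.
Local Hint Resolve lin_starl lin_starr : linbase.

(** Compatibility of the product with the coproducts in bidegree (p, q), by induction on q: the last
    letter M(c (x) e) is split off, and [bcopA] regroups it with the right-hand factor. *)
Lemma star_deg_split p q x y :
  \osum_(u1, u2 <- d (star_deg (p + q) x y)) (homog p u1 \ox homog q u2) =
  bcopY (fun a b c e => star_deg p a b \ox star_deg q c e) x y.
Proof.
elim: q x y => [|q IH] x y.
  rewrite addn0 (deconc_counitrF (F := fun u1 u2 => homog p u1 \ox u2)); last lin.
  rewrite homog_star_deg eqxx.
  rewrite (bcop_counitr Y_yd (F := fun a b c e => star_deg p a b \ox tcat c e)); [|lin..].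
  by rewrite tcat1x.
rewrite addnS star_degS (app_bcop _ _ _ _ _ (@lin_deconc _ _)) (app_bcop _ _ _ _ _ (f := tlift
    _)); last lin.
transitivity (bcopY (fun a b c e => bcopY (fun a1 b1 c1 e1 => star_deg p a1 b1 \ox tcat
    (star_deg q c1 e1) [w M (c \ox e)]) a b) x y).
  (* The cut behind the last letter leaves degree 0 on the right and is killed by [homog q.+1]; all
     other cuts keep that letter on the right. *)
  apply: eq_bcop => a b c' e; rewrite deconc_rconsF; last lin.
  rewrite homog_one (lin0 (lin_pure2 _ (@lin_id _ _))) add0r.
  pose G (t : (T \ox T)%type) := \osum_(u1, u2 <- t) (u1 \ox tcat u2 [w M (c' \ox e)]).
  have l : lin G by rewrite /G; lin.
  transitivity (G (\osum_(u1, u2 <- d (star_deg (p + q) a b)) (homog p u1 \ox homog q u2))).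
    by rewrite /G; nrmR idtac; peel; rewrite homogS_rcons.
  rewrite IH (app_bcop _ _ _ _ _ l); apply: eq_bcop => a1 b1 c1 e1.
  by rewrite /G tlift_pure //; lin.
rewrite bcopA //; [|move=> *; lin..].
apply: eq_bcop => a b c' e.
by rewrite star_degS (app_bcop _ _ _ _ _ (lin_pure2 _ (@lin_id _ _))).
Qed.

Lemma deconc_star x y : d (star x y) = bcopY (fun a b c e => star a b \ox star c e) x y.
Proof.
apply: homog_injlr => p q.
have l : lin (tmap (@homog K V p) (@homog K V q)) by rewrite /tmap; lin.
rewrite (app_bcop _ _ _ _ _ l).
transitivity (bcopY (fun a b c e => star_deg p a b \ox star_deg q c e) x y); last first.
  by apply: eq_bcop => a b c' e; rewrite /tmap tlift_pure ?homog_star //; lin.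
rewrite -star_deg_split -homog_star deconc_homogF; last lin.
have lt : (p < (p + q).+1)%N by rewrite ltnS leq_addr.
(* Of the cuts of the degree p + q part, only the one after p letters survives the projection. *)
rewrite (bigD1 (Ordinal lt)) //= big1 ?addr0 => [|k ne].
  by rewrite /tmap; peel; rewrite addKn !homog_homog !eqxx.
rewrite tliftE big1 // => r _; rewrite homog_homog ifN.
  by rewrite (lin0 (lin_pure1 _ (@lin_id _ _))) scaler0.
by apply: contra ne => /eqP e; apply/eqP/val_inj.
Qed.

Hypothesis M_act : forall h x y, act Y h (M (x \ox y)) =
  \osum_(h1, h2 <- D h) M (act TY h1 x \ox act TY h2 y).
Hypothesis M_coact : forall x y, coact Y (M (x \ox y)) =
  \osum_(a, x0 <- rho x) \osum_(b, y0 <- rho y) ((a * b) \ox M (x0 \ox y0)).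

Lemma star_deg_act n h x y : act TY h (star_deg n x y) =
  \osum_(h1, h2 <- D h) star_deg n (act TY h1 x) (act TY h2 y).
Proof.
elim: n h x y => [|n IH] h x y.
  by rewrite star_deg0 (act_tcat Y_yd); peel; rewrite star_deg0 !(homog_act Y_yd).
rewrite (bcop_act Y_yd); [|lin..].
rewrite star_degS (app_bcop _ _ _ _ _ (lT1 h)); apply: eq_bcop => a b c' e.
rewrite (act_tcat Y_yd); apply: eq_tlift => k l; rewrite IH (act_word1 Y_yd) M_act.
nrmL idtac; rewrite tlift_exch.
by do 2 peel.
Qed.

Lemma star_deg_coact n x y : rho (star_deg n x y) =
  \osum_(a, x0 <- rho x) \osum_(b, y0 <- rho y) ((a * b) \ox star_deg n x0 y0).
Proof.
elim: n x y => [|n IH] x y.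
  rewrite star_deg0 (coact_tcat Y_yd) !(coact_homog Y_yd); nrmL idtac.
  by do 2 peel; rewrite star_deg0.
transitivity (\osum_(a, x0 <- rho x) \osum_(b, y0 <- rho y)
   bcopY (fun p q r s => (a * b) \ox tcat (star_deg n p q) [w M (r \ox s)]) x0 y0); last first.
  by do 2 peel; rewrite star_degS (app_bcop _ _ _ _ _ (lin_pure2 _ (@lin_id _ _))).
rewrite (bcop_coact Y_yd (G := fun a p q r s => a \ox tcat (star_deg n p q) [w M (r \ox s)]));
    [|lin..].
rewrite star_degS (app_bcop _ _ _ _ _ lTC); apply: eq_bcop => p q r s.
by rewrite (coact_tcat Y_yd) IH (coact_word1 Y_yd) M_coact; nrm idtac.
Qed.

Lemma star_act h x y : act TY h (star x y) =
  \osum_(h1, h2 <- D h) star (act TY h1 x) (act TY h2 y).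
Proof.
apply: homog_inj => n; rewrite (app_tlift _ _ (@lin_homog _ _ n)) (homog_act Y_yd) homog_star.
by rewrite star_deg_act; peel; rewrite homog_star.
Qed.

Lemma star_coact x y : rho (star x y) =
  \osum_(a, x0 <- rho x) \osum_(b, y0 <- rho y) ((a * b) \ox star x0 y0).
Proof.
apply: homog_injr => n.
have l : lin (tmap id (@homog K V n) : (H \ox T)%type -> (H \ox T)%type) by rewrite /tmap; lin.
rewrite (app_tlift _ _ l).
transitivity (rho (homog n (star x y))); first by rewrite (coact_homog Y_yd).
rewrite homog_star star_deg_coact; peel; rewrite (app_tlift _ _ l); peel.
by rewrite /tmap tlift_pure ?homog_star //; lin.
Qed.

End StarProduct.

(** * Unit laws and associativity of the product *)

Section StarAlgebra.
Variables (K : fieldType) (H : algType K) (hopf : hopf_algebra H).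
Local Notation D := (comul hopf).
Variables (V : lmodType K) (Y : hstruct H V).
Hypothesis Y_yd : yetter_drinfeld hopf Y.
Local Notation TY := (yd_talg hopf Y).
Local Notation T := (talg V).
Local Notation one := (word [::] : talg V).
Local Notation "[ 'w' v ]" := (word [:: v]) (format "[ 'w'  v ]").
Local Notation d := (@deconc K V).
Local Notation rho := (coact TY).
Local Notation br := (yd_braiding Y).
Local Notation bcopY := (bcop hopf Y).
Implicit Types (x y z : T) (W X : lmodType K).
Local Opaque yd_talg.

Let lT : hlin TY := hlin_talg Y_yd.
Let TYat : forall x, yd_at hopf TY x. Proof. by case/yd_atP: (yd_talgP Y_yd). Qed.

Variable M : T \ox T -> V.
Hypothesis M_qmb : quantum_multibrace br M.
Hypothesis M_yd : forall p q : nat, yd_morphism (yd_tens hopf TY TY) Y (Mcomp M p q).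
Local Notation star := (star br M).
Local Notation starn := (star_deg hopf Y M).

Let lM : lin M. Proof. exact: qmb_linear M_qmb. Qed.

Lemma McompE i j x y : Mcomp M i j (x \ox y) = M (homog i x \ox homog j y).
Proof. by rewrite /Mcomp /tmap tlift_pure //; lin. Qed.

Lemma Mcomp_word s t : Mcomp M (size s) (size t) (word s \ox word t) = M (word s \ox word t).
Proof. by rewrite McompE !homog_word !eqxx. Qed.

Lemma M00 x y : M (homog 0 x \ox homog 0 y) = 0.
Proof. by rewrite -McompE; apply: qmb_M00 M_qmb _. Qed.

(** The axioms M_00 = 0, M_10 = id and M_n0 = 0 for n >= 2 combined: x |-> M(x (x) 1) is the
    projection to V, written as a word of length one to compare it with [homog 1]. *)
Lemma M_one_r x : [w M (x \ox one)] = homog 1 x.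
Proof.
move: x; apply: talg_ext => [||s]; [lin..|].
rewrite -(Mcomp_word s [::]) homog_word; case: s => [|v [|u s]].
- by rewrite (qmb_M00 M_qmb) (lin0 (lin_word1 (@lin_id _ _))).
- by rewrite (qmb_M10 M_qmb).
by rewrite (qmb_Mn0 M_qmb) // (lin0 (lin_word1 (@lin_id _ _))).
Qed.

Lemma M_one_l x : [w M (one \ox x)] = homog 1 x.
Proof.
move: x; apply: talg_ext => [||s]; [lin..|].
rewrite -(Mcomp_word [::] s) homog_word; case: s => [|v [|u s]].
- by rewrite (qmb_M00 M_qmb) (lin0 (lin_word1 (@lin_id _ _))).
- by rewrite (qmb_M01 M_qmb).
by rewrite (qmb_M0n M_qmb) // (lin0 (lin_word1 (@lin_id _ _))).
Qed.

(** The hypothesis concerns the components M_pq; since the action preserves degrees, on words of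
    lengths p and q it is a statement about M. *)
Lemma M_act h x y : act Y h (M (x \ox y)) =
  \osum_(h1, h2 <- D h) M (act TY h1 x \ox act TY h2 y).
Proof.
move: x; apply: talg_ext => [||s]; [lin..|].
move: y; apply: talg_ext => [||t]; [lin..|].
have [_ fA _] := M_yd (size s) (size t).
have lMc : lin (Mcomp M (size s) (size t)) by case: (M_yd (size s) (size t)).
rewrite -Mcomp_word -fA (act_tensE hopf lT lT) (app_tlift _ _ lMc); peel.
by rewrite McompE !(homog_act Y_yd) !homog_word !eqxx.
Qed.

Lemma M_coact x y : coact Y (M (x \ox y)) =
  \osum_(a, x0 <- rho x) \osum_(b, y0 <- rho y) ((a * b) \ox M (x0 \ox y0)).
Proof.
move: x; apply: talg_ext => [||s]; [lin..|].
move: y; apply: talg_ext => [||t]; [lin..|].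
have [_ _ fC] := M_yd (size s) (size t).
have lMc : lin (Mcomp M (size s) (size t)) by case: (M_yd (size s) (size t)).
rewrite -Mcomp_word fC (coact_tensE hopf lT lT) /tmap.
nrmL idtac.
have E u : word u = homog (size u) (word u) :> T by rewrite homog_word eqxx.
rewrite [in RHS](E s) [in RHS](E t) !(coact_homog Y_yd); apply: esym; nrmL idtac.
by do 2 peel; rewrite McompE.
Qed.

Let Lstl := lin_starl Y_yd lM M00.
Let Lstr := lin_starr Y_yd lM M00.
Let hstar := homog_star Y_yd lM M00.

(** As 1 is group-like, the recursion for 1 * x only cuts x: a component of 1 * x_1 is followed by
    M(1 (x) x_2), and by [M_one_l] this is the recursion [homog_split] of x itself. *)
Lemma star1x x : star one x = x.
Proof.
apply: homog_inj => n; rewrite hstar; elim: n x => [|n IH] x.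
  by rewrite star_deg0 homog_one tcat1x.
have L1 := lin_star_degl Y_yd lM n; have L2 := lin_star_degr Y_yd lM n.
rewrite star_degS /bcop deconc1F; last lin.
rewrite (coact_one Y_yd); etransitivity; [apply: eq_tlift => y1 y2|].
  rewrite tlift_pure; last lin.
  by rewrite (at1 (TYat _)) IH M_one_l.
exact: homog_split.
Qed.

Lemma starx1 x : star x one = x.
Proof.
apply: homog_inj => n; rewrite hstar; elim: n x => [|n IH] x.
  by rewrite star_deg0 homog_one tcatx1.
have L1 := lin_star_degl Y_yd lM n; have L2 := lin_star_degr Y_yd lM n.
rewrite star_degS /bcop -homog_split; apply: eq_tlift => x1 x2.
rewrite deconc1F; last lin.
rewrite -[X in _ = tcat _ X]M_one_r -IH.
etransitivity; [|apply: (coact_counitF (hopf := hopf) (F := fun x2 => tcat (starn n x1 one) [w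
    M (x2 \ox one)]) lT (TYat x2)); lin].
by peel; rewrite (act_one Y_yd) (linZ _ _ (L2 _)) (linZ _ _ (@lin_tcatl _ _ _)).
Qed.

(** A nonempty first word kills the counit term, leaving the sum in the exact range of the
    associativity axiom. *)
Lemma star_words (s t : seq V) : (0 < size s)%N ->
  star (word s) (word t) = \sum_(1 <= r < (size s + size t).+1) Mconv br M r (word s \ox word
      t).
Proof.
move=> s0; transitivity (\sum_(n < (size s + size t).+1) starn n (word s) (word t)); last first.
  rewrite big_ord_recl star_deg0 homog_word eqn0Ngt s0 (lin0 (@lin_tcatl _ _ _)) add0r.
  by rewrite big_add1 /= big_mkord; apply: eq_bigr => n _; rewrite (Mconv_star_deg Y_yd lM).
have E u : word u = homog (size u) (word u) :> T by rewrite homog_word eqxx.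
apply: homog_inj => k; rewrite hstar (lin_sum _ _ _ (@lin_homog _ _ k)).
have [le|gt] := leqP k (size s + size t); last first.
  rewrite (E s) (E t) (star_deg_vanish Y_yd lM M00 _ _ gt) -(E s) -(E t) big1 // => n _.
  by rewrite (homog_star_deg _ _ _) ifN //; apply: contraTneq gt => ->; rewrite -leqNgt -ltnS.
have lt : (k < (size s + size t).+1)%N by [].
rewrite (bigD1 (Ordinal lt)) //= homog_star_deg eqxx big1 ?addr0 // => n ne.
by rewrite homog_star_deg ifN //; apply: contra ne => /eqP e; apply/eqP/val_inj.
Qed.

Lemma M_star_words (a b c : seq V) : (0 < size a)%N -> (0 < size b)%N -> (0 < size c)%N ->
  M (star (word a) (word b) \ox word c) = M (word a \ox star (word b) (word c)).
Proof.
move=> a0 b0 c0; rewrite !star_words //.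
have := qmb_assoc M_qmb (in_tuple a) (in_tuple b) (in_tuple c) a0 b0 c0 => /= e.
have l1 : lin (fun x => M (x \ox word c)) by lin.
have l2 : lin (fun x => M (word a \ox x)) by lin.
rewrite (lin_sum _ _ _ l1) (lin_sum _ _ _ l2).
etransitivity; [etransitivity; [|exact: e]|].
  apply: eq_big_nat => r /andP[r0 _]; rewrite McompE homog_word eqxx.
  by case: r r0 => // r _; rewrite (Mconv_star_deg Y_yd lM) homog_star_deg eqxx.
apply: eq_big_nat => r /andP[r0 _]; rewrite McompE homog_word eqxx.
by case: r r0 => // r _; rewrite (Mconv_star_deg Y_yd lM) homog_star_deg eqxx.
Qed.

Lemma star_deg1 x y : starn 1 x y = [w M (x \ox y)].
Proof. by rewrite -(Mconv_star_deg Y_yd lM 0). Qed.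

(** Associativity projected to V. The axiom covers positive degrees; when a word is empty, the unit
    laws remain, together with the fact that the projection of a product to V is M. *)
Lemma M_star x y z : [w M (star x y \ox z)] = [w M (x \ox star y z)].
Proof.
move: x; apply: talg_ext => [||s]; [lin..|].
move: y; apply: talg_ext => [||t]; [lin..|].
move: z; apply: talg_ext => [||u]; [lin..|].
case: s => [|v s]; first by rewrite star1x M_one_l hstar star_deg1.
case: t => [|v' t]; first by rewrite starx1 star1x.
case: u => [|v'' u]; first by rewrite starx1 M_one_r hstar star_deg1.
by rewrite M_star_words.
Qed.

Let scoact := star_coact Y_yd lM M00 M_coact.
Let sact := star_act Y_yd lM M00 M_act.

(** In degree n + 1 both sides unfold to a degree n component followed by a letter. [deconc_star]
    expands the coproduct of the inner product, which crosses x by [star_act] on one side and z by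
    [star_coact] on the other; then [M_star] identifies the letters and induction the rest. *)
Lemma starA x y z : star x (star y z) = star (star x y) z.
Proof.
have L1 n := lin_star_degl Y_yd lM n; have L2 n := lin_star_degr Y_yd lM n.
apply: homog_inj => n; rewrite !hstar.
elim: n x y z => [|n IH] x y z.
  by rewrite !star_deg0 !hstar !star_deg0 tcatA.
rewrite !star_degS /bcop !(deconc_star Y_yd lM M00) /bcop.
etransitivity; [apply: eq_tlift => x1 x2|].
  nrmL ltac:(rewrite ?sact).
  in3 (pull (rho x2)).
  reflexivity.
apply: esym; nrmL ltac:(rewrite ?scoact).
apply: eq_tlift => x1 x2; apply: eq_tlift => y1 y2; pull (d z); apply: eq_tlift => z1 z2.
rwV (coactAF (hopf := hopf) (F := fun g h x' => \osum_(b, y' <- rho y2)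
  tcat (starn n (star x1 (act TY g y1)) (act TY (h * b) z1)) [w M (star x' y' \ox z2)]) lT).
pullR (rho x2); apply: eq_tlift => g x'; pullR (D g); apply: eq_tlift => g1 g2.
by apply: eq_tlift => b y'; rewrite (atM (TYat _)) M_star IH.
Qed.

Lemma homog0_star x y : homog 0 (star x y) = tcat (homog 0 x) (homog 0 y).
Proof. by rewrite hstar star_deg0. Qed.

End StarAlgebra.

(** * The bosonization *)

Section BosonizationBraiding.
Variables (K : fieldType) (H : algType K) (hopf : hopf_algebra H).
Local Notation D := (comul hopf).
Local Notation S := (antipode hopf).
Local Notation eps := (counit hopf).
Variables (V : lmodType K) (Y : hstruct H V).
Hypothesis Y_yd : yetter_drinfeld hopf Y.
Local Notation TY := (yd_talg hopf Y).
Local Notation T := (talg V).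
Local Notation one := (word [::] : talg V).
Local Notation rho := (coact TY).
Local Notation br := (yd_braiding Y).
Implicit Types (x y z : T) (W X : lmodType K).
Local Opaque yd_talg.

Let lT : hlin TY := hlin_talg Y_yd.
Let TYat : forall x, yd_at hopf TY x. Proof. by case/yd_atP: (yd_talgP Y_yd). Qed.

Variable M : T \ox T -> V.
Local Notation star := (star br M).
Hypothesis Lstl : forall y, lin (fun x => star x y).
Hypothesis Lstr : forall x, lin (fun y => star x y).
Hypothesis starA : forall x y z, star x (star y z) = star (star x y) z.
Hypothesis star1x : forall x, star one x = x.
Hypothesis starx1 : forall x, star x one = x.
Hypothesis star_act : forall h x y, act TY h (star x y) =
  \osum_(h1, h2 <- D h) star (act TY h1 x) (act TY h2 y).
Hypothesis star_coact : forall x y, rho (star x y) =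
  \osum_(a, x0 <- rho x) \osum_(b, y0 <- rho y) ((a * b) \ox star x0 y0).
Hypothesis homog0_star : forall x y, homog 0 (star x y) = tcat (homog 0 x) (homog 0 y).

Local Notation A := (bosonization H V).
Local Notation mul := (bos_mul hopf Y M).

Lemma lin_bos_mull b : lin (fun a => mul a b).
Proof. by rewrite /bos_mul; lin. Qed.
Lemma lin_bos_mulr a : lin (fun b => mul a b).
Proof. by rewrite /bos_mul; lin. Qed.
Local Hint Resolve lin_bos_mull lin_bos_mulr : linbase.

Lemma bos_mulE x h y k : mul (x \ox h) (y \ox k) =
  \osum_(h1, h2 <- D h) (star x (act TY h1 y) \ox (h2 * k)).
Proof. by rewrite /bos_mul; nrm idtac. Qed.

Lemma bos_mulA : associative mul.
Proof.
move=> a b e; move: a; apply: tens_ext => [||x h]; [lin..|].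
move: b; apply: tens_ext => [||y k]; [lin..|].
move: e; apply: tens_ext => [||z l]; [lin..|].
rewrite !bos_mulE; nrmL ltac:(rewrite ?bos_mulE ?star_act); apply: esym.
nrmL ltac:(rewrite ?bos_mulE ?comulM).
rwV coassocF; pull (D k); apply: eq_tlift => k1 k2; do 2 peel.
by rewrite starA (atM (TYat _)) mulrA.
Qed.

Lemma bos_mul_oneL g y k : mul (one \ox g) (y \ox k) = \osum_(g1, g2 <- D g) (act TY g1 y \ox
    (g2 * k)).
Proof. by rewrite bos_mulE; peel; rewrite star1x. Qed.

Lemma bos_mul_oneR y k g : mul (y \ox k) (one \ox g) = y \ox (k * g).
Proof.
rewrite bos_mulE -(counitlF hopf (F := fun k => y \ox (k * g)) k); last lin.
by peel; rewrite (act_one Y_yd) (linZ _ _ (Lstr _)) starx1 pureZl.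
Qed.

Lemma bos_mul1 a : mul (one \ox 1) a = a.
Proof.
move: a; apply: tens_ext => [||y k]; [lin..|].
by rewrite bos_mul_oneL comul1; nrmL idtac; rewrite (at1 (TYat _)) mul1r.
Qed.

Definition bos_hstruct : hstruct H A := yd_tens hopf TY (adjoint hopf).
Local Notation Z := bos_hstruct.

Lemma bos_yd : yetter_drinfeld hopf Z.
Proof.
have adj := adjoint_yd hopf; apply: yd_tensP => //; [exact: yd_hlin adj|exact: yd_talgP].
Qed.

Let lZ : hlin Z := yd_hlin bos_yd.

Lemma bos_actE g x k : act Z g (x \ox k) =
  \osum_(g1, g2 <- D g) \osum_(p, q <- D g2) (act TY g1 x \ox (p * k * S q)).
Proof.
have adj := yd_hlin (adjoint_yd hopf).
rewrite /bos_hstruct (act_tensE hopf lT adj); peel.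
exact: (app_tlift _ _ (lin_pure2 _ (@lin_id _ _))).
Qed.

Lemma bos_coactE x h : coact Z (x \ox h) =
  \osum_(a, x0 <- rho x) \osum_(b, h0 <- D h) ((a * b) \ox (x0 \ox h0)).
Proof. exact: coact_tensE lT (yd_hlin (adjoint_yd hopf)) _ _. Qed.

(* [H] acts by the inner (adjoint) action of its image in the bosonization, so
   that [bos_mul_act] is a cancellation of [S h_1 * h_2]. *)
Lemma bos_act_adjoint g a : act Z g a =
  \osum_(g1, g2 <- D g) mul (mul (one \ox g1) a) (one \ox S g2).
Proof.
move: a; apply: tens_ext => [||x k]; [lin..|].
rewrite bos_actE -coassocF; [|lin..]; peel.
rewrite bos_mul_oneL; apply: esym; nrmL idtac.
by peel; rewrite bos_mul_oneR.
Qed.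

Lemma bos_mul_act h a b : act Z h (mul a b) =
  \osum_(h1, h2 <- D h) mul (act Z h1 a) (act Z h2 b).
Proof.
(* [J] is the inclusion of H, multiplicative by [JM]; between a and b the product of the two inner
   actions contains J(S(h_2)) J(h_3), which collapses to the unit J(1). *)
pose J (g : H) : A := one \ox g.
have lJ : lin J by rewrite /J; lin.
have JM u v : mul (J u) (J v) = J (u * v) by rewrite /J bos_mul_oneR.
rewrite bos_act_adjoint; apply: esym.
etransitivity; [apply: eq_tlift => h1 h2; rewrite !bos_act_adjoint -!/(J _); nrm idtac|].
rw coassocF; rewrite -!/(J _).
in1 (rwV coassocF).
apply: eq_tlift => h1 h'.
transitivity (\osum_(q, s <- D h') (eps q *: mul (mul (mul (J h1) a) (J 1)) (mul b (J (S s))))).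
  apply: eq_tlift => q s.
  rewrite -(antipodelF hopf (F := fun u => mul (mul (mul (J h1) a) (J u)) (mul b (J (S s)))));
      last lin.
  apply: eq_tlift => u v; rewrite -JM -/(J u) -/(J v) -/(J (S u)) -/(J (S s)).
  by rewrite !bos_mulA.
rewrite (counitlF hopf (F := fun s => mul (mul (mul (J h1) a) (J 1)) (mul b (J (S s)))));
    last lin.
by rewrite -!bos_mulA bos_mul1.
Qed.

(** Compatibility in T(V) trades (h_1 y)_{-1} h_2 (x) (h_1 y)_0, which comes from the product, for
    h_1 y_{-1} (x) h_2 y_0, which comes from the coactions of the factors. *)
Lemma bos_mul_coact a b : coact Z (mul a b) =
  \osum_(g, a0 <- coact Z a) \osum_(h, b0 <- coact Z b) ((g * h) \ox mul a0 b0).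
Proof.
move: a; apply: tens_ext => [||x h]; [lin..|].
move: b; apply: tens_ext => [||y k]; [lin..|].
rewrite bos_mulE !bos_coactE; nrmL ltac:(rewrite ?bos_coactE ?star_coact ?comulM).
apply: esym; nrmL ltac:(rewrite ?bos_mulE).
apply: esym; pull (rho x); apply: eq_tlift => a x0.
etransitivity; [apply: eq_tlift => h1 h2; pull (D h2); reflexivity|].
rwV coassocF.
apply: esym; pull (D h).
etransitivity; [apply: eq_tlift => h1 h2; pull (D h2); reflexivity|].
rwV coassocF; apply: eq_tlift => h' h3; apply: esym.
etransitivity; [do 2 apply: eq_tlift => ? ?; apply: eq_tlift => k1 k2;
    rewrite -mulrA [X in a * X]mulrA; reflexivity|].
rwV (compatF (hopf := hopf) (F := fun g y0 => \osum_(k1, k2 <- D k)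
  ((a * (g * k1)) \ox (star x0 y0 \ox (h3 * k2)))) lT).
by do 3 peel; rewrite !mulrA.
Qed.

(** The coaction component of x # h is x_{-1} h_1, acting diagonally on y # h' and adjointly on h';
    multiplicativity of the coproduct distributes it over the places in Sigma, up to bracketing of
    iterated coproducts. *)
Lemma bos_braidingE t : bos_braiding hopf Y t = yd_braiding Z t.
Proof.
rewrite /bos_braiding /yd_braiding; apply: eq_tlift => a b.
move: a; apply: tens_ext => [||x h]; [lin..|].
move: b; apply: tens_ext => [||y k]; [lin..|].
rewrite bos_coactE; apply: esym; nrmL ltac:(rewrite ?bos_actE ?comulM).
apply: esym; nrmL idtac; apply: eq_tlift => g x0.
pull (D h); apply: eq_tlift => h' h4.
rw coassocF; apply: eq_tlift => g1 g'.
in1 (rw coassocF).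
by pull (D h'); peel; pullR (D g'); do 2 peel.
Qed.

Lemma bos_projE x h : bos_proj (x \ox h : A) = homog 0 x \ox h.
Proof.
rewrite /bos_proj tlift_pure ?homog0E //.
have l : lin (fun x : T => counitT x *: one) by apply: lin_scalel; exact: lin_counitT.
by lin.
Qed.

Lemma lin_bos_proj : lin (@bos_proj K H V).
Proof.
have l : lin (fun x : T => counitT x *: one) by apply: lin_scalel; exact: lin_counitT.
by rewrite /bos_proj; lin.
Qed.
Local Hint Resolve lin_bos_proj : linbase.

Lemma bos_proj_morphism : yd_morphism Z Z (@bos_proj K H V).
Proof.
split; first exact: lin_bos_proj.
  move=> h; apply: tens_ext => [||x k]; [lin..|].
  rewrite bos_projE !bos_actE; nrmL ltac:(rewrite ?bos_projE); apply: esym; nrmL idtac.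
  by do 2 peel; rewrite (homog_act Y_yd).
have lP : lin (@bos_proj K H V : (T \ox H)%type -> (T \ox H)%type) := lin_bos_proj.
apply: tens_ext => [||x k]; [lin|rewrite /tmap; lin|].
rewrite bos_projE !bos_coactE (coact_homog Y_yd) /tmap; nrmL idtac; apply: esym;
    nrmL ltac:(rewrite ?bos_projE).
by do 2 peel.
Qed.

Lemma bos_proj_idem a : bos_proj (bos_proj a) = bos_proj a :> A.
Proof.
move: a; apply: tens_ext => [||x h]; [lin..|].
by rewrite !bos_projE homog_homog.
Qed.

(** The degree 0 projection is multiplicative for * and commutes with the action of H. *)
Lemma bos_projM a b : bos_proj (mul a b) = mul (bos_proj a) (bos_proj b) :> A.
Proof.
move: a; apply: tens_ext => [||x h]; [lin..|].
move: b; apply: tens_ext => [||y k]; [lin..|].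
rewrite !bos_projE !bos_mulE (app_tlift _ _ lin_bos_proj); peel.
rewrite bos_projE homog0_star -!(homog_act Y_yd) (homog0E x).
by rewrite (linZ _ _ (@lin_tcatl _ _ _)) (linZ _ _ (Lstl _)) tcat1x star1x.
Qed.

Lemma bos_rota_baxter : rota_baxter (-1) mul (@bos_proj K H V).
Proof.
split; first by split; [split; [exact: lin_bos_mull|exact: lin_bos_mulr]|exact: bos_mulA].
  exact: lin_bos_proj.
(* All three terms on the right become the left-hand side, the last one with sign -1. *)
by move=> a b; rewrite !bos_projM !bos_proj_idem scaleN1r addrK.
Qed.

End BosonizationBraiding.

Theorem theorem3p8 (K : fieldType) (charK0 : [pchar K] =i pred0)
    (H : algType K) (hopf : hopf_algebra H) (antipode_bij : bijective (antipode hopf))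
    (V : lmodType K) (Y : hstruct H V) (Y_yd : yetter_drinfeld hopf Y)
    (M : talg V \ox talg V -> V)
    (M_qmb : quantum_multibrace (yd_braiding Y) M)
    (M_yd : forall p q : nat,
      yd_morphism (yd_tens hopf (yd_talg hopf Y) (yd_talg hopf Y)) Y (Mcomp M p q)) :
  braided_rota_baxter (-1) (bos_mul hopf Y M) (@bos_proj K H V) (bos_braiding hopf Y).
Proof.
have lM : lin M := qmb_linear M_qmb.
have m00 := M00 M_qmb.
have Lstl := lin_starl Y_yd lM m00.
have Lstr := lin_starr Y_yd lM m00.
have sA := starA Y_yd M_qmb M_yd.
have s1x := star1x Y_yd M_qmb.
have sx1 := starx1 Y_yd M_qmb.
have sact := star_act Y_yd lM m00 (M_act Y_yd M_qmb M_yd).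
have scoact := star_coact Y_yd lM m00 (M_coact Y_yd M_qmb M_yd).
have h0 := homog0_star Y_yd M_qmb.
have ZE : bos_braiding hopf Y = yd_braiding (bos_hstruct hopf Y).
  by apply: boolp.funext => t; apply: bos_braidingE.
have RB := bos_rota_baxter Y_yd Lstl Lstr sA s1x sact h0.
split=> //.
  have [alg _ _] := RB.
  rewrite ZE; apply: (yd_braided_algebra (bos_yd Y_yd)) => //.
    exact: bos_mul_act.
  exact: bos_mul_coact.
by move=> t; rewrite ZE; apply: (yd_braiding_nat (bos_yd Y_yd)); apply: bos_proj_morphism.
Qed.
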